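(* Let $B$ be a connected oriented $3$-manifold, $u:B\to\mathbb{R}^{3,3}=H^2(T^4,\mathbb{R})$ a minimal immersion with positive definite induced metric $g$, where $2g(A_1,A_2)\,dx^{1234}=u_*(A_1)\wedge u_*(A_2)$, and let $X=B\times T^4$ be the corresponding semi-flat $G_2$-manifold, with $3$-form $\phi=dvol_B+du$. Let $U$ be a vector field on $X$ commuting with the $T^4$-action and satisfying $$\mathcal{L}_U\phi=\lambda\phi+2\lambda\,dvol_B$$ for some function $\lambda$. Write $U=V+W$ with $V=V^\mu\frac{\partial}{\partial b^\mu}$ the component along $B$ and $W=W^i\frac{\partial}{\partial x^i}$ the component along $T^4$. Then $\lambda$ is constant and $W$ is a vector field generated by the $T^4$-action (i.e. the $W^i$ are constant). If $\lambda\neq0$, then after replacing $u$ by $u+c$ for a constant $c$ we have $u_*(V)=\lambda u$, and near each point of $B$ where $V\ne 0$ the immersed $3$-fold is a cone: there are local coordinates $(\sigma,r)\in\Sigma\times I$, with $\Sigma$ a surface and $I\subset(0,\infty)$ an open interval, in which $u(\sigma,r)=r\,u_1(\sigma)$ for a map $u_1:\Sigma\to\mathbb{R}^{3,3}$, and the induced metric is $g=dr^2+r^2g_\Sigma$ with $g_\Sigma$ a metric on $\Sigma$ independent of $r$.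
   Context: $T^4=(\mathbb{R}/\mathbb{Z})^4$ with coordinates $x^1,\dots,x^4$ (volume normalised to $1$); $H^2(T^4,\mathbb{R})$ is identified with constant-coefficient $2$-forms $u_{ij}dx^{ij}$ and carries the signature $(3,3)$ wedge-product form. $b^\mu$ are local coordinates on $B$; $dvol_B$ is the volume form of $g$; $u$ is regarded as the $2$-form $u_{ij}(b)dx^{ij}$ on $X$. The orientation of $B$ is such that $\phi$ is pointwise equivalent to the standard $3$-form $\phi_0 = e^{123} + e^1\wedge(e^{45}+e^{67}) + e^2\wedge(e^{46}-e^{57}) + e^3\wedge(-e^{47}-e^{56})$ stabilised by $G_2$; minimality of $u$ is then equivalent to $X$ being a $G_2$-manifold ($d\phi=0$ and $d{*\phi}=0$), and the fibres of $X\to B$ are coassociative flat tori. $T^4$ acts on $X$ by translations of the second factor. *)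

(* Defs.v *)
From HB Require Import structures.
From mathcomp Require Import all_boot all_order all_algebra.
From mathcomp Require Import all_classical all_reals all_analysis.
Import Order.TTheory GRing.Theory Num.Theory numFieldNormedType.Exports.
Set Implicit Arguments.
Unset Strict Implicit.
Unset Printing Implicit Defensive.
Local Open Scope classical_set_scope.
Local Open Scope ring_scope.

(* [C_on k O f] is meant for [O] open in a finite-dimensional [E]: [f] has     *)
(* continuous iterated directional derivatives up to order [k] on [O].        *)
Fixpoint C_on (R : realType) (E F : normedModType R) (k : nat) (O : set E)
    (f : E -> F) : Prop :=
  match k with
  | 0%N => forall x, O x -> {for x, continuous f}
  | k'.+1 => (forall x, O x -> differentiable f x) /\
             (forall v, C_on k' O (fun x => 'D_v f x))
  end.

Definition smooth_on (R : realType) (E F : normedModType R) (O : set E)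
    (f : E -> F) : Prop := forall k, C_on k O f.

(** Smooth manifolds *)

(* A chart is a homeomorphism [cmap] from the open set [cdom] onto an open    *)
(* set of [E]; [cmap] and [cinv] are only meaningful on [cdom] and its image. *)
Record chart (R : realType) (M : topologicalType) (E : normedModType R) :=
  Chart {
    cdom : set M;
    cmap : M -> E;
    cinv : E -> M;
    cdom_open : open cdom;
    cimg_open : open (cmap @` cdom);
    cmapK : forall b, cdom b -> cinv (cmap b) = b;
    cmap_continuous : {within cdom, continuous cmap};
    cinv_continuous : {within cmap @` cdom, continuous cinv} }.

Definition cimg (R : realType) (M : topologicalType) (E : normedModType R)
  (c : chart M E) : set E := cmap c @` cdom c.

Definition transition (R : realType) (M : topologicalType)
  (E F : normedModType R) (c : chart M E) (d : chart M F) : E -> F :=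
  cmap d \o cinv c.

Definition compatible (R : realType) (M : topologicalType)
    (E F : normedModType R) (c : chart M E) (d : chart M F) : Prop :=
  smooth_on (cmap c @` (cdom c `&` cdom d)) (transition c d) /\
  smooth_on (cmap d @` (cdom c `&` cdom d)) (transition d c).

(* The orientation is the one for which every chart of the atlas is positive. *)
Record oriented_manifold (R : realType) (n : nat) := OrientedManifold {
  carrier :> topologicalType;
  atlas : set (chart carrier 'rV[R]_n);
  manifold_hausdorff : hausdorff_space carrier;
  manifold_second_countable : @second_countable carrier;
  atlas_cover : forall b : carrier, exists2 c, atlas c & cdom c b;
  atlas_compatible : forall c d, atlas c -> atlas d -> compatible c d;
  atlas_oriented : forall c d, atlas c -> atlas d ->
    forall b, cdom c b -> cdom d b ->
      0 < \det (jacobian (transition c d) (cmap c b)) }.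

Definition smooth_map (R : realType) (n : nat) (B : oriented_manifold R n)
    (F : normedModType R) (f : B -> F) : Prop :=
  forall c, atlas c -> smooth_on (cimg c) (f \o cinv c).

(** Linear algebra of the forms *)

(* Coordinates are numbered from 1. *)
Definition coordinate (R : realType) (n : nat) (i : nat) (a : 'rV[R]_n.+1) : R :=
  a ord0 (inord i.-1).

(* $e^{ij}$ and $e^{ijk}$ *)
Definition e2 (R : realType) (n : nat) (i j : nat) (a b : 'rV[R]_n.+1) : R :=
  \det (\matrix_(p < 2, q < 2)
          coordinate (tnth [tuple i; j] q) (tnth [tuple a; b] p)).

Definition e3 (R : realType) (n : nat) (i j k : nat)
    (a b c : 'rV[R]_n.+1) : R :=
  \det (\matrix_(p < 3, q < 3)
          coordinate (tnth [tuple i; j; k] q) (tnth [tuple a; b; c] p)).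

Definition phi0 (R : realType) (a b c : 'rV[R]_7) : R :=
  e3 1 2 3 a b c
  + (e3 1 4 5 a b c + e3 1 6 7 a b c)
  + (e3 2 4 6 a b c - e3 2 5 7 a b c)
  + (- e3 3 4 7 a b c - e3 3 5 6 a b c).

(* H^2(T^4,R) has basis dx^12, dx^13, dx^14, dx^23, dx^24, dx^34. *)
Definition H2 (R : realType) := 'rV[R]_6.

Definition form_of_H2 (R : realType) (w : H2 R) (a b : 'rV[R]_4) : R :=
  coordinate 1 w * e2 1 2 a b + coordinate 2 w * e2 1 3 a b + coordinate 3 w * e2 1 4 a b
  + coordinate 4 w * e2 2 3 a b + coordinate 5 w * e2 2 4 a b + coordinate 6 w * e2 3 4 a b.

(* The coefficient of dx^1234 in [w /\ v]: dx^12/\dx^34 = dx^14/\dx^23 =      *)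
(* dx^1234 and dx^13/\dx^24 = - dx^1234.                                      *)
Definition wedge (R : realType) (w v : H2 R) : R :=
  coordinate 1 w * coordinate 6 v - coordinate 2 w * coordinate 5 v + coordinate 3 w * coordinate 4 v
  + coordinate 4 w * coordinate 3 v - coordinate 5 w * coordinate 2 v + coordinate 6 w * coordinate 1 v.

Definition H2_metric (R : realType) (w v : H2 R) : R := wedge w v / 2.

(** Geometry of a map into H^2(T^4,R), in coordinates *)

Definition induced_metric (R : realType) (E : normedModType R)
    (f : E -> H2 R) (y : E) (a b : E) : R :=
  H2_metric ('D_a f y) ('D_b f y).

Definition basis_vec (R : realType) (n : nat) (i : 'I_n) : 'rV[R]_n :=
  delta_mx ord0 i.

Definition gram (R : realType) (n : nat) (f : 'rV[R]_n -> H2 R)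
    (y : 'rV[R]_n) : 'M[R]_n :=
  \matrix_(i, j) induced_metric f y (basis_vec R i) (basis_vec R j).

(* Component of [w] orthogonal to the image of the differential of [f]. *)
Definition normal_part (R : realType) (n : nat) (f : 'rV[R]_n -> H2 R)
    (y : 'rV[R]_n) (w : H2 R) : H2 R :=
  w - \sum_i \sum_j (invmx (gram f y) i j
        * H2_metric w ('D_(basis_vec R j) f y)) *: 'D_(basis_vec R i) f y.

Definition second_fundamental_form (R : realType) (n : nat)
    (f : 'rV[R]_n -> H2 R) (y : 'rV[R]_n) (i j : 'I_n) : H2 R :=
  normal_part f y
    ('D_(basis_vec R i) (fun z => 'D_(basis_vec R j) f z) y).

Definition mean_curvature (R : realType) (n : nat)
    (f : 'rV[R]_n -> H2 R) (y : 'rV[R]_n) : H2 R :=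
  \sum_i \sum_j invmx (gram f y) i j *: second_fundamental_form f y i j.

Section Immersion.
Variables (R : realType) (B : oriented_manifold R 3) (u : B -> H2 R).

Definition is_immersion : Prop :=
  smooth_map u /\
  forall c, atlas c -> forall y, cimg c y ->
    forall a : 'rV[R]_3, 'D_a (u \o cinv c) y = 0 -> a = 0.

Definition positive_definite_metric : Prop :=
  forall c, atlas c -> forall y, cimg c y ->
    forall a : 'rV[R]_3, a != 0 -> 0 < induced_metric (u \o cinv c) y a a.

Definition is_minimal : Prop :=
  forall c, atlas c -> forall y, cimg c y -> mean_curvature (u \o cinv c) y = 0.

End Immersion.

(** Exterior and Lie derivatives on an open set of a vector space *)

(* A form [w] has value [w z a b] at the point [z] on the vectors [a], [b]. *)
Definition ext_deriv2 (R : realType) (E : normedModType R)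
    (w : E -> E -> E -> R) (z : E) (a b c : E) : R :=
  'D_a (fun z' => w z' b c : R^o) z - 'D_b (fun z' => w z' a c : R^o) z
  + 'D_c (fun z' => w z' a b : R^o) z.

Definition lie_deriv3 (R : realType) (E : normedModType R)
    (U : E -> E) (w : E -> E -> E -> E -> R) (z : E) (a b c : E) : R :=
  'D_(U z) (fun z' => w z' a b c : R^o) z
  + w z ('D_a U z) b c + w z a ('D_b U z) c + w z a b ('D_c U z).

(** The torus T^4 = R^4/Z^4 and X = B * T^4 *)

(* The subgroup Z^4 of the vectors with integer coordinates. *)
Definition lattice (R : realType) : zmodClosed 'rV[R]_4 :=
  GRing.ZmodClosed.clone 'rV[R]_4 (mxOver_pred (@Num.int_num_subdef R)) _.

Definition T4 (R : realType) := Quotient.quot (lattice R).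

Definition T4_class (R : realType) (x : 'rV[R]_4) : T4 R :=
  \pi_(Quotient.quot (lattice R))%qT x.

Section SemiFlat.
Variables (R : realType) (B : oriented_manifold R 3).

(* A chart [c] of [B] gives the coordinates (b^1,b^2,b^3,x^1,..,x^4), the x^i *)
(* being defined up to integers: [Xparam c] is the corresponding local        *)
(* diffeomorphism from [cimg c `*` setT] to X. Fields and forms on X are      *)
(* described by their components in these coordinates.                        *)
Definition Xmodel := ('rV[R]_3 * 'rV[R]_4)%type.

Definition Xparam (c : chart B 'rV[R]_3) (z : Xmodel) : B * T4 R :=
  (cinv c z.1, T4_class z.2).

Record vector_field := VectorField {
  vcomp : chart B 'rV[R]_3 -> B * T4 R -> Xmodel;
  vcomp_transition : forall c d, atlas c -> atlas d ->
    forall p : B * T4 R, cdom c p.1 -> cdom d p.1 ->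
    vcomp d p =
      ('D_((vcomp c p).1) (transition c d) (cmap c p.1), (vcomp c p).2);
  vcomp_smooth : forall c, atlas c ->
    smooth_on (cimg c `*` setT) (vcomp c \o Xparam c) }.

Definition commutes_with_T4 (U : vector_field) : Prop :=
  forall c, atlas c -> forall (b : B) (q t : T4 R), cdom c b ->
    vcomp U c (b, q + t) = vcomp U c (b, q).

Variable u : B -> H2 R.

Definition u_form (c : chart B 'rV[R]_3) (z : Xmodel) (v1 v2 : Xmodel) : R :=
  form_of_H2 (u (cinv c z.1)) v1.2 v2.2.

Definition dvol (c : chart B 'rV[R]_3) (z : Xmodel) (v1 v2 v3 : Xmodel) : R :=
  Num.sqrt (\det (gram (u \o cinv c) z.1)) * e3 1 2 3 v1.1 v2.1 v3.1.

Definition phi (c : chart B 'rV[R]_3) (z : Xmodel) (v1 v2 v3 : Xmodel) : R :=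
  dvol c z v1 v2 v3 + ext_deriv2 (u_form c) z v1 v2 v3.

Definition is_G2_form : Prop :=
  forall c, atlas c -> forall z : Xmodel, cimg c z.1 ->
    exists2 L : {linear Xmodel -> 'rV[R]_7}, bijective L &
      forall v1 v2 v3, phi c z v1 v2 v3 = phi0 (L v1) (L v2) (L v3).

Definition lie_equation (U : vector_field) (lambda : B * T4 R -> R) : Prop :=
  forall c, atlas c -> forall z : Xmodel, cimg c z.1 ->
    forall v1 v2 v3 : Xmodel,
    lie_deriv3 (vcomp U c \o Xparam c) (phi c) z v1 v2 v3 =
      lambda (Xparam c z) * phi c z v1 v2 v3
      + 2 * lambda (Xparam c z) * dvol c z v1 v2 v3.

End SemiFlat.

(* Near [b0] there are coordinates (sigma,r) in [Sigma `*` ]r0,r1[], with     *)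
(* [Sigma] a coordinate patch of a surface, exhibiting [u] as a cone.         *)
Definition is_cone_near (R : realType) (B : oriented_manifold R 3)
    (u : B -> H2 R) (b0 : B) : Prop :=
  exists (k : chart B ('rV[R]_2 * R^o)%type) (Sigma : set 'rV[R]_2)
    (r0 r1 : R) (u1 : 'rV[R]_2 -> H2 R) (gSigma : 'rV[R]_2 -> 'M[R]_2),
  [/\ cdom k b0,
      (forall c, atlas c -> compatible c k),
      [/\ open Sigma, 0 <= r0, r0 < r1 & cimg k = Sigma `*` `]r0, r1[ ],
      [/\ smooth_on Sigma u1,
          forall s r, Sigma s -> r0 < r < r1 -> u (cinv k (s, r)) = r *: u1 s,
          smooth_on Sigma gSigma &
          forall s, Sigma s -> (gSigma s)^T = gSigma s /\
            forall a : 'rV[R]_2, a != 0 ->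
              0 < (a *m gSigma s *m a^T) ord0 ord0] &
      forall s r, Sigma s -> r0 < r < r1 -> forall a b : 'rV[R]_2 * R^o,
        induced_metric (u \o cinv k) (s, r) a b =
          a.2 * b.2 + r ^+ 2 * (a.1 *m gSigma s *m b.1^T) ord0 ord0].

(* Main.v *)
(* Write [f] for [u] in a chart and [h = D_V f].                              *)
(* - On a horizontal vector [a] and two vertical ones, the Lie equation says  *)
(*   [D_V (D_a f) + D_(D_a V) f = lambda D_a f], that is [dh = lambda df].    *)
(*   Symmetry of the second derivatives of [f] and [h] then gives             *)
(*   [D_b lambda D_a f = D_a lambda D_b f], so [lambda] is locally constant.  *)
(* - On two horizontal vectors and a vertical one it says that the            *)
(*   contractions of [D_a f] with [D_b W] and of [D_b f] with [D_a W] agree.  *)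
(*   Two-forms on R^4 satisfy the Clifford relation of the wedge product, and *)
(*   for an orthogonal basis of the tangent space it forces [dW = 0].         *)
(* - If [lambda = l] is not zero, [h / l - f] is locally constant, hence a    *)
(*   constant [c0], and [D_V (f + c0) = l (f + c0)]. For [f' = f + c0],       *)
(*   [rho = |f'|] and [n = f' / rho] this gives [D_V rho = l rho] and         *)
(*   [D_V n = 0]. For [a], [b] spanning the orthogonal of [V] at the base     *)
(*   point, the products of [n] with the fixed vectors [D_a f'] and [D_b f']  *)
(*   together with [rho] are local coordinates in which [n] does not depend   *)
(*   on [rho]; they exhibit [f' = rho n] as a cone.                           *)
Require Import Defs.
From HB Require Import structures.
From mathcomp Require Import all_boot all_order all_algebra.
From mathcomp Require Import all_classical all_reals all_analysis.
From mathcomp Require Import ring lra.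
Import Order.TTheory GRing.Theory Num.Theory numFieldNormedType.Exports.
Local Open Scope classical_set_scope.
Local Open Scope ring_scope.

Set Implicit Arguments.
Unset Strict Implicit.
Unset Printing Implicit Defensive.

(** * Differentials and directional derivatives *)

(** The T^4-symmetry makes the components [V] and [W] of the field functions of the base point
    alone. In a chart, with [f = u \o cinv c], the form [phi] is [dvol] plus [du], and [dvol]
    vanishes as soon as one argument is vertical. The Lie equation with one or two vertical
    arguments therefore only sees [du], and these two cases carry everything.

    Two vertical arguments ([lie_vertical], [derive_stretch]) give dh = lambda df for h = D_V f.
    Since second derivatives commute ([derive_comm]), D_v lambda D_w f is symmetric in v and w;
    testing this on vectors with orthogonal images yields d lambda = 0 ([derive_lambda]). One
    vertical argument ([lie_mixed]) makes the contraction of D_a f with D_b W symmetric in a and b.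
    Contraction is a Clifford action of H^2, and an orthogonal frame of three non-null vectors
    admits no nonzero solution ([clifford_linear]), so dW = 0. Connectedness makes both conclusions
    global ([locally_constant]).

    If lambda = l is nonzero, h / l - f is constant ([center_global]), so after a translation the
    position vector is tangent: it equals u_*(V) / l. Where V is nonzero it thus has positive norm,
    although the form on H^2 is indefinite, and it splits into [radius] and [direction]; V rescales
    the first and fixes the second. The radius and two products of the direction with fixed vectors
    are local coordinates ([cone_map_regular], [inverse_function]) in which the direction is
    independent of the radius. They give a chart of B ([change_chart]), and differentiating the unit
    norm of the direction removes the cross terms of the metric ([cone_near]). *)

Section Differential.
Variables (R : realType) (E F G : normedModType R).
Implicit Types (f g : E -> F) (x v : E).

Lemma derive_comp f (g : F -> G) x v :
  differentiable f x -> differentiable g (f x) ->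
  'D_v (g \o f) x = 'D_('D_v f x) g (f x).
Proof.
move=> df dg; rewrite !deriveE//; last exact: differentiable_comp.
by rewrite diff_comp.
Qed.

Lemma near_eq_differentiable f g x :
  (\near x, f x = g x) -> differentiable f x -> differentiable g x.
Proof.
move=> fg df; apply/diff_locallyP.
have fgx : f x = g x by exact: (nbhs_singleton fg).
have fg0 : \forall h \near 0, f (h + x) = g (h + x).
  by move: fg; rewrite (near_shift 0)/=; apply: filterS => h /=; rewrite subr0.
have o : g \o shift x = cst (g x) + 'd f x +o_ 0 id.
  apply/eqaddoP => e e0.
  have /diff_locally/eqaddoP/(_ e e0) := df.
  apply: filterS2 fg0 => h fgh.
  by rewrite /= !fctE /= fgh fgx.
have -> := diff_unique (diff_continuous df) o.
by split => //; exact: diff_continuous.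
Qed.

Lemma deriveDdir f x u v : differentiable f x ->
  'D_(u + v) f x = 'D_u f x + 'D_v f x.
Proof. by move=> df; rewrite !deriveE// linearD. Qed.

Lemma deriveZdir f x (a : R) v : differentiable f x ->
  'D_(a *: v) f x = a *: 'D_v f x.
Proof. by move=> df; rewrite !deriveE// linearZ. Qed.

Lemma derive_linear (L : {linear E -> F}) x v : continuous L -> 'D_v L x = L v.
Proof.
move=> cL; rewrite deriveE; last exact: linear_differentiable.
by rewrite diff_lin.
Qed.

Lemma differentiable_eps f (L : {linear E -> F}) x : continuous L ->
  (forall e : R, 0 < e -> \forall h \near (0 : E),
     `|f (h + x) - f x - L h| <= e * `|h|) ->
  differentiable f x /\ forall v, 'D_v f x = L v.
Proof.
move=> cL H.
have o : f \o shift x = cst (f x) + L +o_ 0 id.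
  apply/eqaddoP => e e0; apply: filterS (H e e0) => h.
  by rewrite /= !fctE /= opprD addrA.
have dfL := diff_unique cL o.
have df : differentiable f x.
  by apply/diff_locallyP; rewrite dfL.
by split => // v; rewrite deriveE// dfL.
Qed.

Lemma differentiable_eps_near f x : differentiable f x -> forall e : R, 0 < e ->
  \forall h \near (0 : E), `|f (h + x) - f x - 'd f x h| <= e * `|h|.
Proof.
move=> /diff_locally/eqaddoP df e e0; apply: filterS (df e e0) => h.
by rewrite /= !fctE /= opprD addrA.
Qed.

End Differential.

Section Bilinear.
Variables (R : realType) (E F G H : normedModType R).
Variables (b : {bilinear F -> G -> H}) (cb : continuous (fun p => b p.1 p.2)).

Lemma differentiable_bilinear (f : E -> F) (g : E -> G) x :
  differentiable f x -> differentiable g x ->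
  differentiable (fun y => b (f y) (g y)) x.
Proof.
move=> df dg.
apply: (@differentiable_comp _ _ _ _ (fun y => (f y, g y)) (fun p => b p.1 p.2)).
  exact: differentiable_pair.
exact: differentiable_bilin.
Qed.

Lemma derive_bilinear (f : E -> F) (g : E -> G) x v :
  differentiable f x -> differentiable g x ->
  'D_v (fun y => b (f y) (g y)) x = b ('D_v f x) (g x) + b (f x) ('D_v g x).
Proof.
move=> df dg.
rewrite !deriveE//; last exact: differentiable_bilinear.
rewrite (@diff_comp _ _ _ _ (fun y => (f y, g y)) (fun p => b p.1 p.2))/=.
- by rewrite diff_bilin//= diff_pair//= addrC.
- exact: differentiable_pair.
- exact: differentiable_bilin.
Qed.

End Bilinear.

Section Scale.
Variables (R : realType) (E F : normedModType R).

(** A named copy of scaling, with scalars in the normed module [R^o], to which a bilinear structure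
    can be attached; Leibniz rules for products then come from the bilinear case. *)
Definition scale_op (a : R^o) (x : F) : F := a *: x.

Lemma scale_op_bilinear :
  bilinear_for
    (GRing.Scale.Law.clone _ _ *:%R _) (GRing.Scale.Law.clone _ _ *:%R _)
    scale_op.
Proof.
split=> [u'|u] a x y; rewrite /scale_op /=.
- by rewrite scalerDl scalerA.
- by rewrite scalerDr !scalerA mulrC.
Qed.

HB.instance Definition _ :=
  bilinear_isBilinear.Build R R^o F F _ _ scale_op scale_op_bilinear.

Lemma scale_op_continuous : continuous (fun p : R^o * F => scale_op p.1 p.2).
Proof.
move=> p; rewrite /scale_op.
exact: scale_continuous.
Qed.

Lemma differentiable_scale (s : E -> R^o) (h : E -> F) x :
  differentiable s x -> differentiable h x ->
  differentiable (fun y => s y *: h y) x.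
Proof. exact: (differentiable_bilinear scale_op_continuous). Qed.

Lemma derive_scale (s : E -> R^o) (h : E -> F) x v :
  differentiable s x -> differentiable h x ->
  'D_v (fun y => s y *: h y) x = 'D_v s x *: h x + s x *: 'D_v h x.
Proof. exact: (derive_bilinear scale_op_continuous). Qed.

End Scale.

(** * Functions of class C^k *)

Section ClassCk.
Variables (R : realType) (E F : normedModType R).
Implicit Types (f g : E -> F) (O : set E).

Lemma C_on_sub k O O' f : O' `<=` O -> C_on k O f -> C_on k O' f.
Proof.
move=> O'O; elim: k f => [|k IH] f /=; first by move=> cf x /O'O/cf.
by move=> [df Df]; split => [x /O'O/df|v]//; exact: IH (Df v).
Qed.

Lemma C_on_diff k O f x : C_on k.+1 O f -> O x -> differentiable f x.
Proof. by move=> [df _]; exact: df. Qed.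

Lemma C_onW k O f : C_on k.+1 O f -> C_on k O f.
Proof.
elim: k f => [f [df _] x /df/differentiable_continuous//|k IH f [df Df]].
by split => // v; exact/IH/Df.
Qed.

Lemma C_on_continuous k O f x : C_on k O f -> O x -> {for x, continuous f}.
Proof. by elim: k => [|k IH] Cf Ox; [exact: Cf|exact/IH/Ox/C_onW]. Qed.

(** On an open set equality on [O] is equality near each point, so derivatives agree too. This is
    what allows a derivative to be replaced by a Leibniz or chain rule formula valid only on [O]. *)
Lemma C_on_ext k O f g : open O -> {in O, f =1 g} -> C_on k O f -> C_on k O g.
Proof.
move=> oO; elim: k f g => [|k IH] f g fg.
  move=> cf x Ox.
  have nfg : \forall y \near x, f y = g y.
    by apply: filterS (open_nbhs_nbhs (conj oO Ox)) => y Oy; apply: fg; rewrite inE.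
  rewrite /prop_for /continuous_at -(nbhs_singleton nfg).
  by apply: cvg_trans (cf x Ox); exact: near_eq_cvg.
have nfg x : O x -> \forall y \near x, f y = g y.
  by move=> Ox; apply: filterS (open_nbhs_nbhs (conj oO Ox)) => y Oy;
    apply: fg; rewrite inE.
move=> [df Df]; split => [x Ox|v].
  by apply: near_eq_differentiable (df x Ox); exact: nfg.
apply: IH (Df v) => x; rewrite inE => Ox; apply: near_eq_derive; exact: nfg.
Qed.

Lemma C_on_cst k O (a : F) : C_on k O (fun=> a).
Proof.
elim: k a => [|k IH] a; first by move=> x _; exact: cvg_cst.
split => [x _|v]; first exact: differentiable_cst.
have D0 : 'D_v (fun=> a) = fun=> (0 : F).
  by apply/funext => x; exact: (derive_cst a).
by rewrite D0.
Qed.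

Lemma C_onD k O f g : open O -> C_on k O f -> C_on k O g ->
  C_on k O (fun x => f x + g x).
Proof.
move=> oO; elim: k f g => [|k IH] f g.
  by move=> cf cg x Ox; apply: cvgD; [exact: cf|exact: cg].
move=> [df Df] [dg Dg]; split => [x Ox|v].
  by apply: differentiableD; [exact: df|exact: dg].
apply: (C_on_ext oO _ (IH _ _ (Df v) (Dg v))) => x; rewrite inE => Ox.
by apply/esym/deriveD; apply: diff_derivable; [exact: df|exact: dg].
Qed.

Lemma C_on_sum k O (I : Type) (r : seq I) (P : pred I) (f : I -> E -> F) :
  open O -> (forall i, P i -> C_on k O (f i)) ->
  C_on k O (fun x => \sum_(i <- r | P i) f i x).
Proof.
move=> oO Cf; elim: r => [|i r IH].
  by under [X in C_on _ _ X]eq_fun do rewrite big_nil; exact: C_on_cst.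
have [Pi|Pi] := boolP (P i).
  under [X in C_on _ _ X]eq_fun do rewrite big_cons Pi.
  by apply: C_onD => //; exact: Cf.
by under [X in C_on _ _ X]eq_fun do rewrite big_cons (negbTE Pi).
Qed.

Lemma C_on_linear k O (L : {linear E -> F}) : continuous L -> C_on k O L.
Proof.
move=> cL; case: k => [x _|k]; first exact: cL.
split => [x _|v]; first exact: linear_differentiable.
rewrite (_ : (fun _ => _) = fun=> L v); first exact: C_on_cst.
by apply/funext => x; exact: derive_linear.
Qed.

End ClassCk.

Section ClassCkBilinear.
Variables (R : realType) (E F G H : normedModType R).
Variables (b : {bilinear F -> G -> H}) (cb : continuous (fun p => b p.1 p.2)).

Lemma C_on_bilinear k (O : set E) (f : E -> F) (g : E -> G) : open O ->
  C_on k O f -> C_on k O g -> C_on k O (fun x => b (f x) (g x)).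
Proof.
move=> oO; elim: k f g => [|k IH] f g Cf Cg.
  move=> x Ox.
  apply: (@continuous_comp _ _ _ (fun y => (f y, g y)) (fun p => b p.1 p.2)).
    by apply: cvg_pair; [exact: Cf|exact: Cg].
  exact: cb.
have df := @C_on_diff _ _ _ _ _ _ _ Cf; have dg := @C_on_diff _ _ _ _ _ _ _ Cg.
split => [x Ox|v].
  by apply: (differentiable_bilinear cb); [exact: df|exact: dg].
have C1 := IH _ _ (Cf.2 v) (C_onW Cg).
have C2 := IH _ _ (C_onW Cf) (Cg.2 v).
apply: (C_on_ext oO _ (C_onD oO C1 C2)) => x; rewrite inE => Ox.
by apply/esym/(derive_bilinear cb); [exact: df|exact: dg].
Qed.

End ClassCkBilinear.

Section ClassCkLinear.
Variables (R : realType) (E F G : normedModType R).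

Lemma C_on_linear_comp k (O : set E) (f : E -> F) (L : {linear F -> G}) :
  open O -> continuous L -> C_on k O f -> C_on k O (fun x => L (f x)).
Proof.
move=> oO cL; elim: k f => [|k IH] f Cf.
  by move=> x Ox; apply: continuous_comp; [exact: Cf|exact: cL].
split => [x Ox|v].
  apply: (@differentiable_comp _ _ _ _ f L); first exact: Cf.1.
  exact: linear_differentiable.
apply: (C_on_ext oO _ (IH _ (Cf.2 v))) => x; rewrite inE => Ox.
rewrite (@derive_comp _ _ _ _ f L)//; last exact: linear_differentiable.
- by rewrite derive_linear.
- exact: Cf.1.
Qed.

Lemma C_on_comp_linear k (O : set F) (f : F -> G) (L : {linear E -> F}) :
  open O -> continuous L -> C_on k O f -> C_on k (L @^-1` O) (fun x => f (L x)).
Proof.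
move=> oO cL; elim: k f => [|k IH] f Cf.
  by move=> x Ox; apply: continuous_comp; [exact: cL|exact: Cf].
have oLO : open (L @^-1` O) by apply: open_comp => // x _; exact: cL.
split => [x Ox|v].
  apply: (@differentiable_comp _ _ _ _ L f); first exact: linear_differentiable.
  exact: Cf.1.
apply: (C_on_ext oLO _ (IH _ (Cf.2 (L v)))) => x; rewrite inE => Ox.
rewrite (@derive_comp _ _ _ _ L f)//; last exact: Cf.1.
- by rewrite derive_linear.
- exact: linear_differentiable.
Qed.

End ClassCkLinear.

Section ClassCkScale.
Variables (R : realType) (E F : normedModType R) (O : set E).
Hypothesis oO : open O.

Lemma C_on_scale k (s : E -> R^o) (h : E -> F) :
  C_on k O s -> C_on k O h -> C_on k O (fun x => s x *: h x).
Proof. exact: (C_on_bilinear (@scale_op_continuous R F)). Qed.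

Lemma C_onM k (s t : E -> R^o) :
  C_on k O s -> C_on k O t -> C_on k O (fun x => s x * t x : R^o).
Proof. exact: (C_on_bilinear (@scale_op_continuous R R^o)). Qed.

Lemma C_onN k (f : E -> F) : C_on k O f -> C_on k O (fun x => - f x).
Proof.
move=> Cf; under [X in C_on _ _ X]eq_fun do rewrite -scaleN1r.
by apply: (@C_on_bilinear _ _ _ _ _ _ (@scale_op_continuous R F)) => //;
  exact: C_on_cst.
Qed.

Lemma C_onB k (f g : E -> F) : C_on k O f -> C_on k O g ->
  C_on k O (fun x => f x - g x).
Proof. by move=> Cf Cg; apply: C_onD => //; exact: C_onN. Qed.

Lemma C_on_prod k (I : Type) (r : seq I) (P : pred I) (f : I -> E -> R^o) :
  (forall i, P i -> C_on k O (f i)) ->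
  C_on k O (fun x => \prod_(i <- r | P i) f i x : R^o).
Proof.
move=> Cf; elim: r => [|i r IH].
  by under [X in C_on _ _ X]eq_fun do rewrite big_nil; exact: C_on_cst.
have [Pi|Pi] := boolP (P i).
  under [X in C_on _ _ X]eq_fun do rewrite big_cons Pi.
  by apply: C_onM => //; exact: Cf.
by under [X in C_on _ _ X]eq_fun do rewrite big_cons (negbTE Pi).
Qed.

(** The derivative of 1/s is a polynomial in 1/s and the derivative of s, so the induction on the
    order closes. [C_on_sqrt] follows the same pattern. *)
Lemma C_onV k (s : E -> R^o) : (forall x, O x -> s x != 0) ->
  C_on k O s -> C_on k O (fun x => (s x)^-1 : R^o).
Proof.
move=> s0; elim: k => [|k IH] Cs.
  by move=> x Ox; apply: cvgV; [exact: s0|exact: Cs].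
split => [x Ox|v]; first by apply: differentiableV; [exact: Cs.1|exact: s0].
have CV := IH (C_onW Cs).
have C1 : C_on k O (fun x => -1 * ((s x)^-1 * (s x)^-1 * 'D_v s x) : R^o).
  exact: (C_onM (C_on_cst k O (-1 : R^o)) (C_onM (C_onM CV CV) (Cs.2 v))).
apply: (C_on_ext oO _ C1) => x; rewrite inE => Ox; apply/esym.
rewrite (_ : (s x)^-1 * _ = s x ^- 2); last by rewrite expr2 invfM.
by rewrite mulN1r -mulNr; apply: deriveV; [exact: s0|apply/diff_derivable/Cs.1].
Qed.

Lemma C_on_sqrt k (s : E -> R^o) : (forall x, O x -> 0 < s x) ->
  C_on k O s -> C_on k O (fun x => Num.sqrt (s x) : R^o).
Proof.
move=> s0; elim: k => [|k IH] Cs.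
  move=> x Ox; apply: (@continuous_comp _ _ _ s); first exact: Cs.
  exact: sqrt_continuous.
have dsq x : O x -> is_derive (s x) 1 (@Num.sqrt R) (2 * Num.sqrt (s x))^-1.
  by move=> Ox; apply: is_derive1_sqrt; exact: s0.
have dsq' x : O x -> differentiable (Num.sqrt : R^o -> R^o) (s x).
  by move=> /dsq d; apply/derivable1_diffP; case: d.
split => [x Ox|v].
  by apply: (@differentiable_comp _ _ _ _ s); [exact: Cs.1|exact: dsq'].
have CV : C_on k O (fun x => (Num.sqrt (s x))^-1 : R^o).
  by apply: C_onV => [x Ox|]; [rewrite gt_eqF// sqrtr_gt0 s0|exact/IH/C_onW].
have C2 := C_onM (C_on_cst k O (2^-1 : R^o)) (C_onM (Cs.2 v) CV).
apply: (C_on_ext oO _ C2) => x; rewrite inE => Ox; apply/esym.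
rewrite (@derive_comp _ _ _ _ s (Num.sqrt : R^o -> R^o)); last 2 first.
- exact: Cs.1.
- exact: dsq'.
set d := 'D_v s x; rewrite -[d in LHS]mulr1 deriveZdir; last exact: dsq'.
have [_ ->] := dsq x Ox.
by rewrite invfM mulrCA.
Qed.

End ClassCkScale.

Section Coordinates.
Variable R : realType.

Definition mxcoord m n (i : 'I_m) (j : 'I_n) (A : 'M[R]_(m, n)) : R^o := A i j.

Lemma mxcoord_is_linear m n i j : linear (@mxcoord m n i j).
Proof. by move=> a A B; rewrite /mxcoord !mxE. Qed.

HB.instance Definition _ m n i j :=
  GRing.isLinear.Build R 'M[R]_(m, n) R^o _ (@mxcoord m n i j)
    (@mxcoord_is_linear m n i j).

Lemma mxcoord_continuous m n i j : continuous (@mxcoord m n i j).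
Proof. exact: coord_continuous. Qed.

Variable E : normedModType R.

Lemma derive_mxcoord m n (f : E -> 'M[R]_(m, n)) x v i j : differentiable f x ->
  ('D_v f x) i j = 'D_v (fun y => f y i j : R^o) x.
Proof.
by move=> df; rewrite derive_mx ?mxE//; exact: diff_derivable.
Qed.

Lemma differentiable_mxcoord m n (f : E -> 'M[R]_(m, n)) x i j :
  differentiable f x -> differentiable (fun y => f y i j : R^o) x.
Proof.
move=> df; apply: (@differentiable_comp _ _ _ _ f (@mxcoord m n i j)) => //.
by apply: linear_differentiable; exact: mxcoord_continuous.
Qed.

Lemma C_on_mxcoord k (O : set E) m n (f : E -> 'M[R]_(m, n)) i j :
  open O -> C_on k O f -> C_on k O (fun x => f x i j : R^o).
Proof.
by move=> oO; apply: (@C_on_linear_comp _ _ _ _ _ _ _ (@mxcoord m n i j)) => //;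
  exact: mxcoord_continuous.
Qed.

Lemma C_on_mx k (O : set E) m n (f : E -> 'M[R]_(m, n)) : open O ->
  (forall i j, C_on k O (fun x => f x i j : R^o)) -> C_on k O f.
Proof.
move=> oO Cf.
rewrite (_ : f = fun x => \sum_i \sum_j f x i j *: delta_mx i j); last first.
  by apply/funext => x; exact: matrix_sum_delta.
apply: C_on_sum => // i _; apply: C_on_sum => // j _.
by apply: (@C_on_scale _ _ _ _ oO _ (fun x => f x i j)) => //; exact: C_on_cst.
Qed.

Lemma C_on_det k (O : set E) n (A : E -> 'M[R]_n) : open O ->
  (forall i j, C_on k O (fun x => A x i j : R^o)) ->
  C_on k O (fun x => \det (A x) : R^o).
Proof.
move=> oO CA; rewrite /determinant; apply: C_on_sum => // s _.
apply: (@C_onM _ _ _ oO _ (fun=> _)); first exact: C_on_cst.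
by apply: C_on_prod => // i _; exact: CA.
Qed.

(** Cramer's rule: the entries are cofactors divided by the determinant. *)
Lemma C_on_invmx k (O : set E) n (A : E -> 'M[R]_n) : open O ->
  (forall x, O x -> A x \in unitmx) ->
  (forall i j, C_on k O (fun x => A x i j : R^o)) ->
  forall i j, C_on k O (fun x => invmx (A x) i j : R^o).
Proof.
move=> oO uA CA i j.
have CV : C_on k O (fun x => (\det (A x))^-1 : R^o).
  apply: C_onV => //; last exact: C_on_det.
  by move=> x Ox; have := uA x Ox; rewrite unitmxE unitfE.
have Cadj : C_on k O (fun x => (\adj (A x)) i j : R^o).
  under [X in C_on _ _ X]eq_fun do rewrite mxE.
  apply: (@C_onM _ _ _ oO _ (fun=> _)); first exact: C_on_cst.
  apply: C_on_det => // p q.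
  by under [X in C_on _ _ X]eq_fun do rewrite !mxE; exact: CA.
apply: (C_on_ext oO _ (C_onM oO CV Cadj)) => x; rewrite inE => Ox.
by rewrite /invmx uA// [in RHS]mxE.
Qed.

End Coordinates.

Section Composition.
Variables (R : realType) (E G : normedModType R) (n : nat).

Lemma derive_basis (g : 'rV[R]_n -> G) y (v : 'rV[R]_n) : differentiable g y ->
  'D_v g y = \sum_i v ord0 i *: 'D_(basis_vec R i) g y.
Proof.
move=> dg; rewrite deriveE// {1}[v]row_sum_delta linear_sum.
by apply: eq_bigr => i _; rewrite linearZ deriveE.
Qed.

(* The middle space is finite-dimensional, so that the derivative of [g \o f] *)
(* is a finite sum of products of functions that the induction covers.        *)
Lemma C_on_comp k (O : set E) (P : set 'rV[R]_n) (f : E -> 'rV[R]_n)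
    (g : 'rV[R]_n -> G) : open O -> (forall x, O x -> P (f x)) ->
  C_on k O f -> C_on k P g -> C_on k O (g \o f).
Proof.
move=> oO fP; elim: k g => [|k IH] g Cf Cg.
  move=> x Ox; apply: continuous_comp; first exact: Cf.
  exact/Cg/fP.
split => [x Ox|v].
  by apply: differentiable_comp; [exact: Cf.1|exact/Cg.1/fP].
have C1 : C_on k O (fun x => \sum_i ('D_v f x) ord0 i *: 'D_(basis_vec R i) g (f x)).
  apply: C_on_sum => // i _.
  apply: (@C_on_scale _ _ _ _ oO _ (fun x => ('D_v f x) ord0 i)).
    exact/C_on_mxcoord/Cf.2.
  exact: (IH _ (C_onW Cf) (Cg.2 _)).
apply: (C_on_ext oO _ C1) => x; rewrite inE => Ox; apply/esym.
have dg : differentiable g (f x) by exact/Cg.1/fP.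
rewrite (@derive_comp _ _ _ _ f g)//; first exact: derive_basis.
exact: Cf.1.
Qed.

End Composition.

(** * Mean value theorem and symmetry of second derivatives *)

Section MeanValue.
Variables (R : realType) (E : normedModType R).

Lemma is_derive_line (F : normedModType R) (f : E -> F) x v (t : R) :
  differentiable f (x + t *: v) ->
  is_derive (t : R^o) (1 : R^o) (fun s : R^o => f (x + s *: v)) ('D_v f (x + t *: v)).
Proof.
move=> df.
have dl : is_diff (t : R^o) (fun s : R^o => x + s *: v) ( *:%R ^~ v).
  by apply: is_diff_eq; rewrite add0r.
have dfl : differentiable (f \o (fun s : R^o => x + s *: v)) (t : R^o).
  by apply: differentiable_comp => //; exact: ex_diff.
apply: DeriveDef; first exact: diff_derivable.
have dl' := @ex_diff _ _ _ _ _ _ _ dl.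
rewrite (deriveE _ dfl) (diff_comp dl' df)/=.
by rewrite diff_val scale1r (deriveE _ df).
Qed.

Lemma mean_value (f : E -> R^o) x v :
  (forall t : R, 0 <= t <= 1 -> differentiable f (x + t *: v)) ->
  exists2 t : R, 0 <= t <= 1 & f (x + v) - f x = 'D_v f (x + t *: v).
Proof.
move=> df.
have [||t] := @MVT R (fun s => f (x + s *: v)) (fun t => 'D_v f (x + t *: v)) 0 1 ltr01.
- move=> t /[!in_itv]/= /andP[t0 t1]; apply: is_derive_line.
  by apply: df; rewrite !ltW.
- apply: derivable_within_continuous => t /[!in_itv]/= t01.
  by have [] := is_derive_line (df t t01).
rewrite in_itv/= => /andP[t0 t1]; rewrite scale1r scale0r addr0 subr0 mulr1 => ->.
by exists t => //; rewrite !ltW.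
Qed.

(** The norm of a row vector is the largest coordinate, so the scalar mean value theorem applied to
    each coordinate loses no constant. *)
Lemma mean_value_inequality n (f : E -> 'rV[R]_n) x v (M : R) :
  (forall t : R, 0 <= t <= 1 -> differentiable f (x + t *: v)) ->
  (forall t : R, 0 <= t <= 1 -> `|'D_v f (x + t *: v)| <= M) ->
  `|f (x + v) - f x| <= M.
Proof.
move=> df Df.
have M0 : 0 <= M by rewrite (le_trans _ (Df 0 _))// lexx ler01.
rewrite [leLHS]/Num.Def.normr/= mx_normrE (bigmax_le _ M0)//= => -[i j] _ /=.
have [|t t01 e] := @mean_value (fun y => f y i j) x v.
  by move=> t t01; apply: differentiable_mxcoord; exact: df.
rewrite !mxE e -derive_mxcoord; last exact: df.
apply: le_trans (Df t t01).
by rewrite [leRHS]/Num.Def.normr/= mx_normrE; exact: (le_bigmax _ _ (i, j)).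
Qed.

Lemma ball_segment (x0 x y : E) (r t : R) : ball x0 r x -> ball x0 r y ->
  0 <= t <= 1 -> ball x0 r (x + t *: (y - x)).
Proof.
rewrite -!ball_normE /= => bx by_ /andP[t0 t1].
have -> : x0 - (x + t *: (y - x)) = (1 - t) *: (x0 - x) + t *: (x0 - y).
  rewrite scalerBl scale1r -[RHS]addrA -scalerN -scalerDr opprB subrKA.
  by rewrite opprD addrA -scalerN opprB.
apply: le_lt_trans (ler_normD _ _) _; rewrite !normrZ.
rewrite (ger0_norm t0) ger0_norm ?subr_ge0//.
move: bx by_; set p := `|x0 - x|; set q := `|x0 - y| => bx by_.
have [t1'|t1'] := ltP t 1; last by (have -> : t = 1 by lra); lra.
suff : (1 - t) * p + t * q < (1 - t) * r + t * r by lra.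
by apply: ltr_leD; [rewrite ltr_pM2l// subr_gt0|rewrite ler_wpM2l// ltW].
Qed.

Lemma cst_on_ball n (f : E -> 'rV[R]_n) x0 r :
  (forall x, ball x0 r x -> differentiable f x) ->
  (forall x v, ball x0 r x -> 'D_v f x = 0) ->
  forall x y, ball x0 r x -> ball x0 r y -> f x = f y.
Proof.
move=> df Df x y bx by_; apply/esym/eqP; rewrite -subr_eq0 -normr_le0.
rewrite -[in f y](subrKC x y).
apply: mean_value_inequality => t t01.
  by apply: df; exact: ball_segment.
by rewrite Df ?normr0//; exact: ball_segment.
Qed.

End MeanValue.

Section Schwarz.
Variables (R : realType) (E : normedModType R).

(** The mean value theorem is used twice: along [a] for the increment [g (z + b) - g z], then along
    [b] for ['D_a g]. *)
Lemma second_difference (O : set E) (g : E -> R^o) x a b : open O ->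
  C_on 2 O g ->
  (forall s t : R, 0 <= s <= 1 -> 0 <= t <= 1 -> O (x + s *: a + t *: b)) ->
  exists s t : R, [/\ 0 <= s <= 1, 0 <= t <= 1 &
    g (x + a + b) - g (x + a) - (g (x + b) - g x) =
      'D_b ('D_a g) (x + s *: a + t *: b)].
Proof.
move=> oO Cg inO.
have dg s t : 0 <= s <= 1 -> 0 <= t <= 1 -> differentiable g (x + s *: a + t *: b).
  by move=> s01 t01; apply: Cg.1; exact: inO.
have dsh s : 0 <= s <= 1 ->
    is_derive (x + s *: a) a (fun z => g (z + b) - g z)
      ('D_a g (x + s *: a + b) - 'D_a g (x + s *: a)) /\
    differentiable (fun z => g (z + b) - g z) (x + s *: a).
  move=> s01.
  have d1 : differentiable g (x + s *: a).
    by have := dg s 0 s01; rewrite scale0r addr0 lexx ler01; exact.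
  have d2 : differentiable g (x + s *: a + b).
    by have := dg s 1 s01; rewrite scale1r lexx ler01; exact.
  have dsb : is_diff (x + s *: a) (fun z => z + b) id.
    by apply: is_diff_eq; rewrite addr0.
  have d3 : differentiable (g \o (fun z => z + b)) (x + s *: a).
    by apply: differentiable_comp => //; exact: ex_diff.
  split; last exact: differentiableB.
  apply: DeriveDef; first by apply/diff_derivable/differentiableB.
  rewrite (@deriveB _ _ _ (g \o (fun z => z + b)) g); last 2 first.
  - exact: diff_derivable.
  - exact: diff_derivable.
  have dsb' := @ex_diff _ _ _ _ _ _ _ dsb.
  by rewrite (derive_comp _ dsb' d2) (deriveE _ dsb') diff_val.
have [|s s01] := @mean_value _ _ (fun z => g (z + b) - g z) x a.
  by move=> t /dsh[].
rewrite (@derive_val _ _ _ _ _ _ _ (dsh s s01).1).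
have [|t t01 ->] := @mean_value _ _ ('D_a g) (x + s *: a) b.
  by move=> t t01; apply: (Cg.2 a).1; exact: inO.
by exists s, t; split => //; rewrite addrAC.
Qed.

Lemma continuous2_ball (O : set E) (p q : E -> R^o) x (e : R) : open O -> O x ->
  {for x, continuous p} -> {for x, continuous q} -> 0 < e ->
  exists2 d : R, 0 < d & forall y, ball x d y ->
    [/\ `|p x - p y| < e, `|q x - q y| < e & O y].
Proof.
move=> oO Ox cp cq e0.
have n3 : nbhs x O by exact: open_nbhs_nbhs.
have [d1 /= d10 dP1] := (nbhs_ballP x _).1 ((cvgrPdist_lt _ _).1 cp _ e0).
have [d2 /= d20 dP2] := (nbhs_ballP x _).1 ((cvgrPdist_lt _ _).1 cq _ e0).
have [d3 /= d30 dP3] := (nbhs_ballP x _).1 n3.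
exists (Num.min d1 (Num.min d2 d3)); first by rewrite !lt_min d10 d20.
move=> y yb; split; [apply: dP1|apply: dP2|apply: dP3].
- by apply: le_ball yb; rewrite ge_min lexx.
- by apply: le_ball yb; rewrite !ge_min lexx orbT.
- by apply: le_ball yb; rewrite !ge_min lexx !orbT.
Qed.

Lemma dist_halves (e A B X Y : R) : `|A - X| < e / 2 -> `|B - Y| < e / 2 ->
  Y = X -> `|A - B| <= e.
Proof.
move=> AX BY YX; rewrite -(subrKA X) (le_trans (ler_normD _ _))//.
by rewrite (splitr e) lerD// ltW// -?YX// distrC.
Qed.

(** The second difference over a parallelogram is symmetric in its sides. By [second_difference] it
    is a value of one mixed derivative at some point of the parallelogram and of the other mixed
    derivative at another point; both points are close to [x], where the two mixed derivatives are
    continuous. *)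
Lemma derive_comm_scalar (O : set E) (g : E -> R^o) x a b : open O -> O x ->
  C_on 2 O g -> 'D_a ('D_b g) x = 'D_b ('D_a g) x.
Proof.
move=> oO Ox Cg.
apply/eqP; rewrite -subr_eq0 -normr_le0; apply/ler_addgt0Pr => e e0; rewrite add0r.
have cab : {for x, continuous ('D_a ('D_b g))} by exact: ((Cg.2 b).2 a).
have cba : {for x, continuous ('D_b ('D_a g))} by exact: ((Cg.2 a).2 b).
have e2 : 0 < e / 2 by rewrite divr_gt0.
have [d d0 dP] := continuous2_ball oO Ox cab cba e2.
(* This scaling puts the parallelogram with sides [t *: a] and [t *: b] inside the ball of radius
   [d]; the summand 1 keeps the denominator positive when both vectors vanish. *)
pose t := d / 2 / (`|a| + `|b| + 1).
have N0 : 0 < `|a| + `|b| + 1 by rewrite ltr_wpDl// addr_ge0.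
have t0 : 0 < t by rewrite !divr_gt0.
have nz (r : R) (c : E) : 0 <= r <= 1 -> `|r *: (t *: c)| <= t * `|c|.
  move=> /andP[r0 r1]; rewrite scalerA normrZ normrM (ger0_norm r0) (gtr0_norm t0).
  by rewrite -mulrA ler_piMl// mulr_ge0// ltW.
have inb s s' : 0 <= s <= 1 -> 0 <= s' <= 1 ->
    ball x d (x + s *: (t *: a) + s' *: (t *: b)).
  move=> /andP[s0 s1] /andP[s'0 s'1]; rewrite -ball_normE/= -addrA opprD addrA.
  rewrite subrr add0r normrN.
  apply: (@le_lt_trans _ _ (t * (`|a| + `|b| + 1))); last first.
    by rewrite /t divfK ?gt_eqF// ltr_pdivrMr// ltr_pMr// ltr1n.
  apply: le_trans (ler_normD _ _) _; rewrite !mulrDr mulr1.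
  rewrite -[leLHS]addr0 lerD ?(ltW t0)// lerD//.
  - by apply: nz; rewrite s0.
  - by apply: nz; rewrite s'0.
have scal (c c' : E) y : O y -> 'D_(t *: c) ('D_(t *: c') g) y = t ^+ 2 * 'D_c ('D_c' g) y.
  move=> Oy.
  have E1 : 'D_(t *: c) ('D_(t *: c') g) y = 'D_(t *: c) (t *: 'D_c' g) y.
    apply: near_eq_derive; apply: filterS (open_nbhs_nbhs (conj oO Oy)) => z Oz.
    by rewrite deriveZdir//; exact: Cg.1.
  rewrite E1 deriveZ; last exact/diff_derivable/(Cg.2 c').1.
  rewrite deriveZdir; last exact: (Cg.2 c').1.
  by rewrite scalerA -expr2.
have inO p q : 0 <= p <= 1 -> 0 <= q <= 1 -> O (x + p *: (t *: a) + q *: (t *: b)).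
  by move=> p01 q01; have [] := dP _ (inb _ _ p01 q01).
have [s1 [s2 [s1P s2P e1]]] := second_difference oO Cg inO.
have [|s3 [s4 [s3P s4P e2']]] := @second_difference O g x (t *: b) (t *: a) oO Cg.
  by move=> p q p01 q01; rewrite addrAC; exact: inO.
have ee : 'D_b ('D_a g) (x + s1 *: (t *: a) + s2 *: (t *: b)) =
    'D_a ('D_b g) (x + s3 *: (t *: b) + s4 *: (t *: a)).
  apply: (@mulfI _ (t ^+ 2)); first by rewrite expf_neq0// gt_eqF.
  have ba : x + s3 *: (t *: b) + s4 *: (t *: a) = x + s4 *: (t *: a) + s3 *: (t *: b).
    by rewrite addrAC.
  have sc1 := scal b a _ (inO _ _ s1P s2P).
  have sc2 := scal a b _ (inO _ _ s4P s3P); rewrite -ba in sc2.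
  apply: (etrans (esym sc1)); apply: (etrans _ sc2).
  apply: (etrans (esym e1)); apply: (etrans _ e2').
  rewrite (addrAC x (t *: b)).
  have swap (A B C D : R) : A - B - (C - D) = A - C - (B - D) by ring.
  exact: swap.
have [_ B1 _] := dP _ (inb _ _ s1P s2P).
have := inb _ _ s4P s3P; rewrite addrAC => /dP[B2 _ _].
exact: (dist_halves B2 B1 ee).
Qed.

Lemma derive_comm n (O : set E) (g : E -> 'rV[R]_n) x a b : open O -> O x ->
  C_on 2 O g -> 'D_a ('D_b g) x = 'D_b ('D_a g) x.
Proof.
move=> oO Ox Cg; apply/rowP => j.
have comp c c' : ('D_c ('D_c' g) x) ord0 j = 'D_c ('D_c' (fun y => g y ord0 j : R^o)) x.
  rewrite derive_mxcoord; last exact: (Cg.2 c').1.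
  apply: near_eq_derive; apply: filterS (open_nbhs_nbhs (conj oO Ox)) => z Oz.
  by rewrite derive_mxcoord//; exact: Cg.1.
apply: (etrans (comp a b)); apply: (etrans _ (esym (comp b a))).
have Cj : C_on 2 O (fun y => g y ord0 j : R^o) by exact: C_on_mxcoord.
exact: (derive_comm_scalar a b oO Ox Cj).
Qed.

End Schwarz.

(** * Inverse function theorem *)

Section FiniteDimension.
Variables (R : realType) (n : nat) (G : normedModType R).

Lemma rV_linear_continuous (L : {linear 'rV[R]_n -> G}) : continuous L.
Proof.
have CL : C_on 0 setT (fun v : 'rV[R]_n => \sum_i v ord0 i *: L (basis_vec R i)).
  apply: C_on_sum => [|i _]; first exact: openT.
  have Ci : C_on 0 setT (fun v : 'rV[R]_n => v ord0 i : R^o).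
    apply: (@C_on_linear _ _ _ 0 setT (@mxcoord R 1 n ord0 i)).
    exact: mxcoord_continuous.
  exact: (C_on_scale openT Ci (C_on_cst 0 setT (L (basis_vec R i)))).
move=> v; have -> : (L : _ -> _) = fun v : 'rV[R]_n => \sum_i v ord0 i *: L (basis_vec R i).
  apply/funext => w; rewrite {1}[w]row_sum_delta linear_sum.
  by apply: eq_bigr => i _; rewrite linearZ.
exact: CL.
Qed.

End FiniteDimension.

Lemma rV_coord_norm (R : realType) n (v : 'rV[R]_n) i : `|v ord0 i| <= `|v|.
Proof. by rewrite [leRHS]/Num.Def.normr/= mx_normrE; exact: (le_bigmax _ _ (ord0, i)). Qed.

Section Generic.
Variables (R : realType) (E F : normedModType R).

Lemma continuous_ball (p : E -> F) x (e : R) : {for x, continuous p} -> 0 < e ->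
  exists2 d : R, 0 < d & forall y, ball x d y -> `|p x - p y| < e.
Proof.
move=> cp e0; have [d /= d0 dP] := (nbhs_ballP x _).1 ((cvgrPdist_lt _ _).1 cp _ e0).
by exists d.
Qed.

Lemma continuous_family_ball n (p : 'I_n -> E -> F) x (e : R) :
  (forall i, {for x, continuous (p i)}) -> 0 < e ->
  exists2 d : R, 0 < d & forall y, ball x d y -> forall i, `|p i x - p i y| < e.
Proof.
move=> cp e0.
have [d dP] := choice (fun i => let: ex_intro2 d d0 dP := continuous_ball (cp i) e0
  in ex_intro (fun d => 0 < d /\ forall y, ball x d y -> `|p i x - p i y| < e)
       d (conj d0 dP)).
exists (\big[Num.min/1]_(i < n) d i).
  by apply: lt_bigmin => // i _; have [] := dP i.
move=> y yb i; apply: (dP i).2; apply: le_ball yb; exact: bigmin_le_cond.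
Qed.

Lemma lipschitz_C_on0 (P : set E) (f : E -> F) (K : R) : open P -> 0 < K ->
  (forall w w', P w -> P w' -> `|f w - f w'| <= K * `|w - w'|) -> C_on 0 P f.
Proof.
move=> oP K0 lip w Pw; apply/cvgrPdist_le => e e0.
have e1 : 0 < e / K by rewrite divr_gt0.
have nP : nbhs w P by exact: open_nbhs_nbhs.
have nb := nbhsx_ballx w (e / K) e1.
apply: filterS2 nP nb => t Pt; rewrite -ball_normE/= => tw.
apply: le_trans (lip _ _ Pw Pt) _.
by rewrite mulrC -ler_pdivlMr// ltW.
Qed.

(** The Lipschitz bound makes the increment [k] of [theta] of the order of [h]. The error [k - L h]
    is the image under [- L] of the first-order error of [psi] at [k], hence negligible against
    [h]. *)
Lemma differentiable_inverse (P : set F) (psi : E -> F) (theta : F -> E)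
    (L : {linear F -> E}) (K : R) w :
  open P -> P w -> 0 < K -> (forall w', P w' -> psi (theta w') = w') ->
  (forall w w', P w -> P w' -> `|theta w - theta w'| <= K * `|w - w'|) ->
  differentiable psi (theta w) -> continuous L ->
  (forall v, L ('D_v psi (theta w)) = v) ->
  differentiable theta w /\ forall v, 'D_v theta w = L v.
Proof.
move=> oP Pw K0 psiK lip dpsi cL LK; apply: differentiable_eps => // e e0.
have [C C0 CL] := linear_lipschitz cL.
have e1 : 0 < e / (C * K) by rewrite divr_gt0// mulr_gt0.
have [r /= r0 rP] := (nbhs_ballP (0 : E) _).1 (differentiable_eps_near dpsi e1).
have [s /= s0 sP] := (nbhs_ballP w _).1 (open_nbhs_nbhs (conj oP Pw)).
have m0 : 0 < Num.min s (r / K) by rewrite lt_min s0 divr_gt0.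
apply/nbhs_ballP; exists (Num.min s (r / K)) => // h.
rewrite -ball_normE/= sub0r normrN lt_min => /andP[hs hr].
have Phw : P (h + w).
  by apply: sP; rewrite -ball_normE/= opprD addrCA subrr addr0 normrN.
set k := theta (h + w) - theta w.
have kh : `|k| <= K * `|h|.
  by apply: le_trans (lip _ _ Phw Pw) _; rewrite addrK.
have kr : ball 0 r k.
  rewrite -ball_normE/= sub0r normrN (le_lt_trans kh)//.
  by rewrite mulrC -ltr_pdivlMr.
have := rP k kr; rewrite /= /k subrK psiK// psiK// addrK -/k => hk.
have -> : k - L h = - L (h - 'd psi (theta w) k).
  by rewrite linearB/= opprB -deriveE// LK.
rewrite normrN; apply: le_trans (CL _) _.
apply: (@le_trans _ _ (C * (e / (C * K) * (K * `|h|)))).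
  rewrite ler_pM2l//; apply: le_trans hk _; rewrite ler_pM2l//.
rewrite le_eqVlt; apply/orP; left; apply/eqP; field.
by rewrite !gt_eqF.
Qed.

End Generic.

HB.instance Definition _ (R : realType) (m n : nat) := Complete.on 'M[R]_(m, n).

Section Contraction.
Variables (R : realType) (n : nat).
Notation V := 'rV[R]_n.

(** Continuity is only known for each fixed direction; finitely many basis directions suffice for a
    bound uniform in [v]. *)
Lemma derive_near_id (O : set V) (F : V -> V) y0 : open O -> O y0 ->
  C_on 1 O F -> (forall v, 'D_v F y0 = v) ->
  exists2 d : R, 0 < d & forall y, ball y0 d y ->
    O y /\ forall v, `|'D_v F y - v| <= 2^-1 * `|v|.
Proof.
move=> oO Oy0 CF DF0.
(* The [n] basis directions each contribute at most [|v|] times [m]; the successor avoids a division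
   by zero for [n = 0]. *)
pose m : R := 2^-1 / n.+1%:R.
have m0 : 0 < m by rewrite divr_gt0// ?invr_gt0// ltr0n.
have [d1 d10 dP1] := continuous_family_ball
  (fun i => CF.2 (basis_vec R i) y0 Oy0) m0.
have [d2 /= d20 dP2] := (nbhs_ballP y0 _).1 (open_nbhs_nbhs (conj oO Oy0)).
exists (Num.min d1 d2) => [|y yb]; first by rewrite lt_min d10.
have Oy : O y by apply: dP2; apply: le_ball yb; rewrite ge_min lexx orbT.
split => // v.
have yP : forall i, `|'D_(basis_vec R i) F y0 - 'D_(basis_vec R i) F y| < m.
  by apply: dP1; apply: le_ball yb; rewrite ge_min lexx.
have -> : 'D_v F y - v = \sum_i v ord0 i *: ('D_(basis_vec R i) F y - basis_vec R i).
  rewrite derive_basis; last exact: CF.1.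
  rewrite {2}[v]row_sum_delta -sumrB; apply: eq_bigr => i _.
  by rewrite scalerBr.
apply: le_trans (ler_norm_sum _ _ _) _.
apply: (@le_trans _ _ (\sum_(i < n) `|v| * m)).
  apply: ler_sum => i _; rewrite normrZ ler_pM//; first exact: rV_coord_norm.
  by have := yP i; rewrite DF0 distrC => /ltW.
rewrite sumr_const card_ord -[leLHS]mulr_natl /m.
have E (p q r s : R) : r * (p * (q / s)) = q * p * (r / s) by ring.
rewrite E.
rewrite ler_piMr ?mulr_ge0 ?invr_ge0//.
by rewrite ler_pdivrMr ?ltr0n// mul1r ler_nat.
Qed.

(** Solving [F y = z] is finding a fixed point of [y + z - F y], a contraction of ratio 1/2. It
    preserves the closed ball of radius [d / 2], since half of that radius plus the distance [d / 4]
    allowed for [z] is again [d / 2]. *)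
Lemma contraction_surj (F : V -> V) y0 (d : R) : 0 < d ->
  (forall x y, ball y0 d x -> ball y0 d y ->
    `|(F x - x) - (F y - y)| <= 2^-1 * `|x - y|) ->
  forall z, ball (F y0) (d / 4) z -> exists2 y, ball y0 d y & F y = z.
Proof.
move=> d0 Fl z bz.
pose U : set V := [set y | `|y0 - y| <= d / 2].
have Ub y : U y -> ball y0 d y.
  rewrite /U -ball_normE/= => /le_lt_trans; apply.
  by rewrite ltr_pdivrMr// ltr_pMr// ltr1n.
have by0 : ball y0 d y0 by exact: ballxx.
pose f y := y + z - F y.
have fU : {homo f : x / U x >-> U x}.
  move=> y Uy; rewrite /U/= /f.
  have -> : y0 - (y + z - F y) = (F y - y - (F y0 - y0)) + (F y0 - z).
    by apply/rowP => j; rewrite !mxE; ring.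
  apply: le_trans (ler_normD _ _) _.
  have := Fl y y0 (Ub _ Uy) by0; rewrite [`|y - y0|]distrC.
  move: Uy bz; rewrite /U -ball_normE/=.
  by set p := `|y0 - y|; set q := `|F y0 - z|; set r := `|_ - _|; lra.
pose ff : {fun U >-> U} := HB.pack f (isFun.Build _ _ _ _ f fU).
have cf : is_contraction ff.
  exists (2^-1)%:nng; split => /=; first by rewrite invf_lt1// ltr1n.
  move=> [x y] /= [Ux Uy].
  have := Fl x y (Ub _ Ux) (Ub _ Uy); rewrite /f.
  have -> : x + z - F x - (y + z - F y) = - (F x - x - (F y - y)).
    by apply/rowP => j; rewrite !mxE; ring.
  by rewrite normrN.
have clU : closed U.
  have -> : U = closed_ball y0 (d / 2) by rewrite closed_ballE// divr_gt0.
  exact: closed_ball_closed.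
have U0 : U !=set0 by exists y0; rewrite /U/= subrr normr0 divr_ge0// ltW.
have [y Uy yE] := banach_fixed_point cf clU U0.
exists y; first exact: Ub.
have : y = y + z - F y by exact: yE.
by move=> /(congr1 (fun t => t - y + F y)); rewrite subrr add0r => ->; apply/rowP => j; rewrite !mxE; ring.
Qed.

End Contraction.

Section InverseFunction.
Variables (R : realType) (n : nat).
Notation V := 'rV[R]_n.

(** After composition with the inverse Jacobian the map [F] has derivative the identity at [y0], and
    [F - id] is 1/2-Lipschitz nearby. This gives injectivity with a Lipschitz inverse, surjectivity
    onto a small ball, and injectivity of the nearby differentials. *)
Lemma near_inverse (O : set V) (psi : V -> V) y0 : open O -> O y0 ->
  C_on 1 O psi -> (forall v, 'D_v psi y0 = 0 -> v = 0) ->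
  exists (N : set V) (theta : V -> V) (K : R),
  [/\ open N, N y0, N `<=` O, open (psi @` N) &
   [/\ forall y, N y -> theta (psi y) = y,
       0 < K,
       forall x y, N x -> N y -> `|x - y| <= K * `|psi x - psi y| &
       forall y, N y -> forall v, 'D_v psi y = 0 -> v = 0]].
Proof.
move=> oO Oy0 Cpsi inj0.
have dpsi y : O y -> differentiable psi y by exact: Cpsi.1.
pose J := jacobian psi y0.
have DJ v : 'D_v psi y0 = v *m J by rewrite deriveEjacobian//; exact: dpsi.
have uJ : J \in unitmx.
  rewrite -row_free_unit -kermx_eq0; apply/eqP/row_matrixP => i.
  by rewrite row0; apply: inj0; rewrite DJ -row_mul mulmx_ker row0.
pose L : {linear V -> V} := mulmxr (invmx J).
have cL : continuous L by exact: rV_linear_continuous.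
pose F y := L (psi y).
have CF : C_on 1 O F by exact: C_on_linear_comp.
have DF y v : O y -> 'D_v F y = L ('D_v psi y).
  move=> Oy; rewrite (@derive_comp _ _ _ _ psi L); last 2 first.
  - exact: dpsi.
  - exact: linear_differentiable.
  by rewrite derive_linear.
have DF0 v : 'D_v F y0 = v by rewrite DF// DJ /L/= mulmxK.
have [d d0 dP] := derive_near_id oO Oy0 CF DF0.
have Fl x y : ball y0 d x -> ball y0 d y ->
    `|(F x - x) - (F y - y)| <= 2^-1 * `|x - y|.
  move=> bx by_.
  have dif t : 0 <= t <= 1 -> differentiable F (y + t *: (x - y)).
    by move=> t01; apply: CF.1; apply: (dP _ _).1; exact: ball_segment.
  rewrite -[in F x - x](subrKC y x).
  apply: (@mean_value_inequality _ _ _ (fun z => F z - z)) => t t01.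
    by apply: differentiableB; [exact: dif|exact: (ex_diff (f := id))].
  rewrite (@deriveB _ _ _ F id); last 2 first.
  - exact/diff_derivable/dif.
  - exact: derivable_id.
  by rewrite derive_id; apply: (dP _ _).2; exact: ball_segment.
have Fl2 x y : ball y0 d x -> ball y0 d y -> `|x - y| <= 2 * `|F x - F y|.
  move=> bx by_; have := Fl x y bx by_.
  have : `|x - y| <= `|F x - F y| + `|F x - x - (F y - y)|.
    have -> : x - y = (F x - F y) - (F x - x - (F y - y)).
      by apply/rowP => j; rewrite !mxE; ring.
    exact: ler_normB.
  by set p := `|x - y|; set q := `|F x - F y|; set r := `|_ - _|; lra.
(* Cutting by the preimage of the small ball makes [F] map [N] exactly onto that ball, so the image
   of [psi] is open. *)
pose N : set V := ball y0 d `&` F @^-1` (ball (F y0) (d / 4)).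
have NO : N `<=` O by move=> y [by_ _]; have [] := dP y by_.
have FN z : ball (F y0) (d / 4) z -> exists2 y, N y & F y = z.
  move=> bz; have [y by_ yz] := contraction_surj d0 Fl bz.
  by exists y => //; split => //=; rewrite yz.
have Finj x y : N x -> N y -> F x = F y -> x = y.
  move=> [bx _] [by_ _] FF; apply/eqP; rewrite -subr_eq0 -normr_le0.
  by apply: le_trans (Fl2 _ _ bx by_) _; rewrite FF subrr normr0 mulr0.
have oN : open N.
  rewrite openE => y [by_ bFy]; apply: filterI.
    by apply: open_nbhs_nbhs; split => //; exact: ball_open.
  have cF : {for y, continuous F} by apply: (C_on_continuous CF); exact: (dP y by_).1.
  by apply: cF; apply: open_nbhs_nbhs; split => //; apply: ball_open; rewrite divr_gt0.
pose theta w := get [set y | N y /\ psi y = w].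
have [K K0 LK] := linear_lipschitz cL.
exists N, theta, (2 * K); split => //.
- by split => //=; [exact: ballxx|apply: ballxx; rewrite divr_gt0].
- have -> : psi @` N = L @^-1` (ball (F y0) (d / 4)).
    apply/seteqP; split => [_ [y [_ bF] <-]//|w /= /FN[y Ny Fyw]].
    exists y => //; have := congr1 (fun z => z *m J) Fyw.
    by rewrite /F /L/= !mulmxKV.
  apply: open_comp => [w _|]; first exact: cL.
  by apply: ball_open; rewrite divr_gt0.
split => [y Ny||x y [bx _] [by_ _]|y [by_ _] v Dv].
- have [Nt tE] : N (theta (psi y)) /\ psi (theta (psi y)) = psi y.
    by apply: (getPex (P := [set z | N z /\ psi z = psi y])); exists y.
  by apply: Finj => //; rewrite /F tE.
- by rewrite mulr_gt0.
- apply: le_trans (Fl2 x y bx by_) _; rewrite -mulrA ler_pM2l// /F -raddfB.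
  exact: LK.
- have [Oy /(_ v)] := dP y by_.
  rewrite DF// Dv linear0 sub0r normrN => h; apply/eqP; rewrite -normr_le0.
  by move: h; set p := `|v|; lra.
Qed.

(** Bootstrapping: the derivative of [theta] is the inverse Jacobian of [psi] evaluated at [theta].
    If [theta] is of class C^k, so is this expression, hence [theta] is of class C^(k+1). *)
Lemma inverse_function (O : set V) (psi : V -> V) y0 : open O -> O y0 ->
  smooth_on O psi -> (forall v, 'D_v psi y0 = 0 -> v = 0) ->
  exists (N : set V) (theta : V -> V),
  [/\ open N, N y0, N `<=` O, open (psi @` N) &
   [/\ forall y, N y -> theta (psi y) = y,
       smooth_on (psi @` N) theta &
       forall y, N y -> forall v, 'D_v psi y = 0 -> v = 0]].
Proof.
move=> oO Oy0 Cpsi inj0.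
have [N [theta [K [oN Ny0 NO oN' [thetaK K0 lip injN]]]]] :=
  near_inverse oO Oy0 (Cpsi 1) inj0.
exists N, theta; split => //; split => //.
have dpsi y : N y -> differentiable psi y.
  by move=> /NO; exact: (Cpsi 1%N).1.
have thN w : (psi @` N) w -> N (theta w) /\ psi (theta w) = w.
  by move=> [y Ny <-]; rewrite thetaK.
have tlip w w' : (psi @` N) w -> (psi @` N) w' ->
    `|theta w - theta w'| <= K * `|w - w'|.
  move=> /thN[Nw wE] /thN[Nw' wE'].
  by rewrite -[w in leRHS]wE -[w' in leRHS]wE'; exact: lip.
have uJ y : N y -> jacobian psi y \in unitmx.
  move=> Ny; rewrite -row_free_unit -kermx_eq0; apply/eqP/row_matrixP => i.
  rewrite row0; apply: (injN y Ny); rewrite deriveEjacobian; last exact: dpsi.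
  by rewrite -row_mul mulmx_ker row0.
have dt w : (psi @` N) w -> differentiable theta w /\
    forall v, 'D_v theta w = v *m invmx (jacobian psi (theta w)).
  move=> Pw; have [Nw wE] := thN w Pw.
  pose L : {linear V -> V} := mulmxr (invmx (jacobian psi (theta w))).
  apply: (@differentiable_inverse _ _ _ _ psi theta L K w oN' Pw K0) => //.
  - by move=> w' /thN[].
  - exact: dpsi.
  - exact: rV_linear_continuous.
  - move=> v; rewrite deriveEjacobian; last exact: dpsi.
    by rewrite /L/= mulmxK// uJ.
elim=> [|k IH]; first exact: lipschitz_C_on0 tlip.
split => [w Pw|v]; first exact: (dt w Pw).1.
have CJ : forall i j, C_on k (psi @` N) (fun w => jacobian psi (theta w) i j : R^o).
  move=> i j.
  have CDi : C_on k N (fun y => 'D_(basis_vec R i) psi y ord0 j : R^o).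
    by apply: C_on_mxcoord => //; apply: C_on_sub NO _; exact: (Cpsi k.+1).2.
  have CDt := C_on_comp oN' (fun w Pw => (thN w Pw).1) IH CDi.
  apply: (C_on_ext oN' _ CDt) => w; rewrite inE => Pw /=.
  rewrite deriveEjacobian; last by apply: dpsi; have [] := thN w Pw.
  by rewrite /basis_vec -rowE mxE.
have CI := C_on_invmx oN' (fun w Pw => uJ _ (thN w Pw).1) CJ.
have Cv : C_on k (psi @` N) (fun w => v *m invmx (jacobian psi (theta w))).
  apply: C_on_mx => // i j.
  under [X in C_on _ _ X]eq_fun do rewrite mxE.
  apply: C_on_sum => // l _.
  by apply: (C_onM oN') (CI l j); exact: C_on_cst.
by apply: (C_on_ext oN' _ Cv) => w; rewrite inE => Pw; rewrite (dt w Pw).2.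
Qed.

End InverseFunction.

(** * Algebra of two-forms on R^4 *)

Section FormAlgebra.
Variable R : realType.
Implicit Types (w v : H2 R) (x y p : 'rV[R]_4).

Lemma coordinateD n i (a b : 'rV[R]_n.+1) :
  coordinate i (a + b) = coordinate i a + coordinate i b.
Proof. by rewrite /coordinate mxE. Qed.

Lemma coordinateZ n i k (a : 'rV[R]_n.+1) :
  coordinate i (k *: a) = k * coordinate i a.
Proof. by rewrite /coordinate mxE. Qed.

Lemma coordinate0 n i : coordinate i (0 : 'rV[R]_n.+1) = 0.
Proof. by rewrite /coordinate mxE. Qed.

Lemma coordinate_basis n i (j : 'I_n.+1) : (i.-1 <= n)%N ->
  coordinate i (basis_vec R j) = (i.-1 == j)%:R.
Proof.
by move=> hi; rewrite /coordinate /basis_vec mxE eqxx/= -(inj_eq val_inj)/= inordK.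
Qed.

Lemma coordinate_row n i (F : 'I_n.+1 -> R) :
  coordinate i (\row_j F j) = F (inord i.-1).
Proof. by rewrite /coordinate mxE. Qed.

Lemma coordinateP n (a b : 'rV[R]_n.+1) :
  (forall i, (i <= n)%N -> coordinate i.+1 a = coordinate i.+1 b) -> a = b.
Proof.
move=> h; apply/rowP => j; have := h j (ltn_ord j).
by rewrite /coordinate/= inord_val.
Qed.

Lemma e2E n i j (a b : 'rV[R]_n.+1) : e2 i j a b =
  coordinate i a * coordinate j b - coordinate j a * coordinate i b.
Proof.
rewrite /e2 (expand_det_row _ ord0) !big_ord_recl big_ord0 /cofactor !det_mx11 !mxE.
by rewrite !(tnth_nth 0)/=; ring.
Qed.

Lemma e3_eq0 n i j k (a b c : 'rV[R]_n.+1) :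
  [\/ a = 0, b = 0 | c = 0] -> e3 i j k a b c = 0.
Proof.
move=> h; rewrite /e3.
have row0_det m (A : 'M[R]_m) r : (forall s, A r s = 0) -> \det A = 0.
  by move=> A0; rewrite (expand_det_row _ r) big1// => s _; rewrite A0 mul0r.
case: h => ->.
- by apply: (row0_det _ _ ord0) => s; rewrite mxE coordinate0.
- by apply: (row0_det _ _ (@Ordinal 3 1 isT)) => s; rewrite mxE; exact: coordinate0.
- by apply: (row0_det _ _ (@Ordinal 3 2 isT)) => s; rewrite mxE; exact: coordinate0.
Qed.

Lemma form_of_H2D w v x p :
  form_of_H2 (w + v) x p = form_of_H2 w x p + form_of_H2 v x p.
Proof. by rewrite /form_of_H2 !coordinateD; ring. Qed.

Lemma form_of_H2Z k w x p : form_of_H2 (k *: w) x p = k * form_of_H2 w x p.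
Proof. by rewrite /form_of_H2 !coordinateZ; ring. Qed.

Lemma form_of_H2_0l w p : form_of_H2 w 0 p = 0.
Proof. by rewrite /form_of_H2 !e2E !coordinate0; ring. Qed.

Lemma form_of_H2_0r w x : form_of_H2 w x 0 = 0.
Proof. by rewrite /form_of_H2 !e2E !coordinate0; ring. Qed.

Lemma form_of_H2_inj w v : form_of_H2 w =2 form_of_H2 v -> w = v.
Proof.
move=> h; apply: coordinateP => i hi.
have E (k l : nat) := h (basis_vec R (inord k)) (basis_vec R (inord l)).
move: (E 0 1) (E 0 2) (E 0 3) (E 1 2) (E 1 3) (E 2 3).
rewrite /form_of_H2 !e2E !coordinate_basis// !inordK//=.
rewrite !(mulr0, mulr1, mul0r, subr0, addr0, add0r, sub0r, oppr0).
by case: i hi => [|[|[|[|[|[|i]]]]]].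
Qed.

(** The interior product of the two-form [w] with [x], a covector stored as a row. *)
Definition contract w x : 'rV[R]_4 := \row_j form_of_H2 w x (basis_vec R j).

Lemma contractE w x : [/\
  coordinate 1 (contract w x) = - (coordinate 1 w * coordinate 2 x
    + coordinate 2 w * coordinate 3 x + coordinate 3 w * coordinate 4 x),
  coordinate 2 (contract w x) = coordinate 1 w * coordinate 1 x
    - coordinate 4 w * coordinate 3 x - coordinate 5 w * coordinate 4 x,
  coordinate 3 (contract w x) = coordinate 2 w * coordinate 1 x
    + coordinate 4 w * coordinate 2 x - coordinate 6 w * coordinate 4 x &
  coordinate 4 (contract w x) = coordinate 3 w * coordinate 1 x
    + coordinate 5 w * coordinate 2 x + coordinate 6 w * coordinate 3 x].
Proof.
by split; rewrite coordinate_row /form_of_H2 !e2E !coordinate_basis// !inordK//=; ring.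
Qed.

Lemma contractZ w k x : contract w (k *: x) = k *: contract w x.
Proof.
have [a1 a2 a3 a4] := contractE w x; have [b1 b2 b3 b4] := contractE w (k *: x).
apply: coordinateP => -[|[|[|[|i]]]]// _; rewrite coordinateZ.
- by rewrite a1 b1 !coordinateZ; ring.
- by rewrite a2 b2 !coordinateZ; ring.
- by rewrite a3 b3 !coordinateZ; ring.
- by rewrite a4 b4 !coordinateZ; ring.
Qed.

(** The Hodge star of the Euclidean metric on R^4. As a skew matrix, [hodge w] inverts [w] up to
    sign and the Pfaffian, which is [H2_metric w w]. *)
Definition hodge w : H2 R := \row_i
  nth 0 [:: coordinate 6 w; - coordinate 5 w; coordinate 4 w;
            coordinate 3 w; - coordinate 2 w; coordinate 1 w] i.

Lemma hodgeE w : [/\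
  coordinate 1 (hodge w) = coordinate 6 w,
  coordinate 2 (hodge w) = - coordinate 5 w &
  coordinate 3 (hodge w) = coordinate 4 w] /\ [/\
  coordinate 4 (hodge w) = coordinate 3 w,
  coordinate 5 (hodge w) = - coordinate 2 w &
  coordinate 6 (hodge w) = coordinate 1 w].
Proof. by split; split; rewrite coordinate_row inordK. Qed.

Lemma hodgeK : involutive hodge.
Proof.
move=> w; have [[a1 a2 a3] [a4 a5 a6]] := hodgeE w.
have [[b1 b2 b3] [b4 b5 b6]] := hodgeE (hodge w).
by apply: coordinateP => -[|[|[|[|[|[|i]]]]]]// _;
  rewrite ?(b1, b2, b3, b4, b5, b6) ?(a1, a2, a3, a4, a5, a6) ?opprK.
Qed.

Lemma wedge_hodge w v : wedge (hodge w) (hodge v) = wedge w v.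
Proof.
have [[a1 a2 a3] [a4 a5 a6]] := hodgeE w.
have [[b1 b2 b3] [b4 b5 b6]] := hodgeE v.
by rewrite /wedge a1 a2 a3 a4 a5 a6 b1 b2 b3 b4 b5 b6; ring.
Qed.

(* The Clifford relation of the signature (3,3) form on H^2, acting on        *)
(* R^4 + R^4.                                                                 *)
Lemma clifford w v x :
  contract (hodge w) (contract v x) + contract (hodge v) (contract w x) =
  - wedge w v *: x.
Proof.
have [[a1 a2 a3] [a4 a5 a6]] := hodgeE w.
have [[b1 b2 b3] [b4 b5 b6]] := hodgeE v.
have [c1 c2 c3 c4] := contractE w x; have [d1 d2 d3 d4] := contractE v x.
have [f1 f2 f3 f4] := contractE (hodge w) (contract v x).
have [g1 g2 g3 g4] := contractE (hodge v) (contract w x).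
apply: coordinateP => -[|[|[|[|i]]]]// _; rewrite coordinateD coordinateZ /wedge.
- by rewrite f1 g1 a1 a2 a3 b1 b2 b3 c2 c3 c4 d2 d3 d4; ring.
- by rewrite f2 g2 a1 a4 a5 b1 b4 b5 c1 c3 c4 d1 d3 d4; ring.
- by rewrite f3 g3 a2 a4 a6 b2 b4 b6 c1 c2 c4 d1 d2 d4; ring.
- by rewrite f4 g4 a3 a5 a6 b3 b5 b6 c1 c2 c3 d1 d2 d3; ring.
Qed.

Lemma clifford_sq w x :
  contract (hodge w) (contract w x) = - H2_metric w w *: x.
Proof.
have := clifford w w x; rewrite -mulr2n -scaler_nat => /(congr1 (fun t => 2^-1 *: t)).
by rewrite !scalerA mulVf ?pnatr_eq0// scale1r => ->; rewrite mulrN mulrC.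
Qed.

Lemma clifford_orth w v x : wedge w v = 0 ->
  contract (hodge w) (contract v x) = - contract (hodge v) (contract w x).
Proof.
by move=> wv; apply/eqP; rewrite -subr_eq0 opprK clifford wv oppr0 scale0r.
Qed.

Lemma contract_inj0 w x : H2_metric w w != 0 -> contract w x = 0 -> x = 0.
Proof.
move=> w0 wx; have := clifford_sq w x; rewrite wx.
have -> : contract (hodge w) 0 = 0 by have := contractZ (hodge w) 0 0; rewrite !scale0r.
by move=> /esym/eqP; rewrite scaler_eq0 oppr_eq0 (negbTE w0) => /eqP.
Qed.

Lemma H2_metric_hodge w v : H2_metric (hodge w) (hodge v) = H2_metric w v.
Proof. by rewrite /H2_metric wedge_hodge. Qed.

(* With [J_b] standing for [contract fb] after the inverse of [contract fa],  *)
(* the three hypotheses say [Wb = J_b Wa], [Wc = J_c Wa] and                  *)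
(* [J_c J_b Wa = J_b J_c Wa], while [J_b] and [J_c] anticommute.              *)
Lemma clifford_kernel fa fb fc x y z :
  wedge fa fb = 0 -> wedge fa fc = 0 -> wedge fb fc = 0 ->
  H2_metric fa fa != 0 -> H2_metric fb fb != 0 -> H2_metric fc fc != 0 ->
  contract fa y = contract fb x -> contract fa z = contract fc x ->
  contract fb z = contract fc y -> x = 0.
Proof.
move=> ab ac bc a0 b0 c0 yx zx zy.
have hy := congr1 (contract (hodge fa)) yx; rewrite clifford_sq in hy.
have hz := congr1 (contract (hodge fa)) zx; rewrite clifford_sq in hz.
have swap w v t : wedge w v = 0 ->
    contract w (contract (hodge v) t) = - contract v (contract (hodge w) t).
  by move=> wv; rewrite -{1}(hodgeK w) clifford_orth ?wedge_hodge// hodgeK.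
have e : contract fb (contract (hodge fa) (contract fc x)) =
         contract fc (contract (hodge fa) (contract fb x)).
  by rewrite -hy -hz !contractZ zy.
have ba : wedge fb fa = 0 by rewrite -ab /wedge; ring.
have ca : wedge fc fa = 0 by rewrite -ac /wedge; ring.
rewrite (swap fb fa)// (swap fc fa)// (clifford_orth _ bc) in e.
have cN w t : contract w (- t) = - contract w t by rewrite -scaleN1r contractZ scaleN1r.
rewrite cN opprK in e.
have : contract fa (contract (hodge fc) (contract fb x)) = 0.
  have : contract fa (contract (hodge fc) (contract fb x)) *+ 2 = 0.
    by rewrite mulr2n {1}e addNr.
  by move/eqP; rewrite -scaler_nat scaler_eq0 pnatr_eq0/= => /eqP.
move=> /(contract_inj0 a0)/contract_inj0 h.
by apply: (contract_inj0 b0); apply: h; rewrite H2_metric_hodge.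
Qed.

End FormAlgebra.

Section Metric.
Variable R : realType.

Lemma H2_metric_bilinear :
  bilinear_for
    (GRing.Scale.Law.clone _ _ *:%R _) (GRing.Scale.Law.clone _ _ *:%R _)
    (@H2_metric R : H2 R -> H2 R -> R^o).
Proof.
by split=> [w|w] a x y; rewrite /H2_metric /wedge /= !coordinateD !coordinateZ /GRing.scale /=; ring.
Qed.

HB.instance Definition _ :=
  bilinear_isBilinear.Build R (H2 R) (H2 R) R^o _ _ (@H2_metric R) H2_metric_bilinear.

Lemma H2_metric_continuous :
  continuous (fun p : H2 R * H2 R => H2_metric p.1 p.2 : R^o).
Proof.
have oT : open [set: H2 R * H2 R] by exact: openT.
have Cf i : C_on 0 setT (fun p : H2 R * H2 R => coordinate i p.1 : R^o).
  move=> p _; apply: (@continuous_comp _ _ _ fst (fun w : H2 R => coordinate i w : R^o)).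
    exact: cvg_fst.
  exact: coord_continuous.
have Cs i : C_on 0 setT (fun p : H2 R * H2 R => coordinate i p.2 : R^o).
  move=> p _; apply: (@continuous_comp _ _ _ snd (fun w : H2 R => coordinate i w : R^o)).
    exact: cvg_snd.
  exact: coord_continuous.
have C0 : C_on 0 setT (fun p : H2 R * H2 R => H2_metric p.1 p.2 : R^o).
  have Cm i j := C_onM oT (Cf i) (Cs j).
  exact: (C_onM oT (C_onD oT (C_onB oT (C_onD oT (C_onD oT (C_onB oT (Cm 1 6)
    (Cm 2 5)) (Cm 3 4)) (Cm 4 3)) (Cm 5 2)) (Cm 6 1)) (C_on_cst 0 setT (2^-1 : R^o)))%N.
by move=> p; exact: C0.
Qed.

Lemma H2_metricDl (u w v : H2 R) : H2_metric (u + w) v = H2_metric u v + H2_metric w v.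
Proof. by rewrite /H2_metric /wedge !coordinateD; ring. Qed.

Lemma H2_metricZl k (w v : H2 R) : H2_metric (k *: w) v = k * H2_metric w v.
Proof. by rewrite /H2_metric /wedge !coordinateZ; ring. Qed.

Lemma H2_metricC (w v : H2 R) : H2_metric w v = H2_metric v w.
Proof. by rewrite /H2_metric /wedge; ring. Qed.

Lemma H2_metricDr (u w v : H2 R) : H2_metric v (u + w) = H2_metric v u + H2_metric v w.
Proof. by rewrite H2_metricC H2_metricDl !(H2_metricC v). Qed.

Lemma H2_metricZr k (w v : H2 R) : H2_metric v (k *: w) = k * H2_metric v w.
Proof. by rewrite H2_metricC H2_metricZl (H2_metricC v). Qed.

Lemma H2_metric0l (v : H2 R) : H2_metric 0 v = 0.
Proof. by have := H2_metricZl 0 0 v; rewrite scale0r mul0r. Qed.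

Lemma H2_metric_suml n (k : 'I_n -> R) (v : 'I_n -> H2 R) (w : H2 R) :
  H2_metric (\sum_i k i *: v i) w = \sum_i k i * H2_metric (v i) w.
Proof.
elim/big_rec2: _ => [|i x y _ <-]; first exact: H2_metric0l.
by rewrite H2_metricDl H2_metricZl.
Qed.

End Metric.

Section Orthogonal.
Variable R : realType.

Lemma orthogonal_exists n m (M : 'M[R]_(n, m)) : (m < n)%N ->
  exists2 c : 'rV[R]_n, c != 0 & c *m M = 0.
Proof.
move=> mn; have K0 : kermx M != 0.
  rewrite kermx_eq0 /row_free; apply: contraL mn => /eqP <-.
  by rewrite -leqNgt rank_leq_col.
have /rowV0Pn[c /sub_kermxP cM c0] := K0.
by exists c.
Qed.

Variables (f : {linear 'rV[R]_3 -> H2 R}).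
Hypothesis f_pos : forall a, a != 0 -> 0 < H2_metric (f a) (f a).

Lemma H2_orthogonal (s : seq 'rV[R]_3) : (size s < 3)%N ->
  exists2 c, c != 0 & forall a, a \in s -> H2_metric (f c) (f a) = 0.
Proof.
move=> s3.
pose M := \matrix_(i < 3, j < size s) H2_metric (f (basis_vec R i)) (f (nth 0 s j)).
have [c c0 cM] := orthogonal_exists M s3.
exists c => // a /(nthP 0)[j js <-].
have := congr1 (fun A : 'rV_(size s) => A ord0 (Ordinal js)) cM.
rewrite !mxE => <-.
rewrite {1}[c]row_sum_delta linear_sum.
under eq_bigr do rewrite linearZ/=.
by rewrite H2_metric_suml; apply: eq_bigr => i _; rewrite mxE.
Qed.

(** The given vector [a] is completed to a frame whose images under [f] are pairwise orthogonal; the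
    three symmetry relations on this frame are those of [clifford_kernel]. *)
Lemma clifford_linear (W : {linear 'rV[R]_3 -> 'rV[R]_4}) :
  (forall a b p, form_of_H2 (f a) (W b) p = form_of_H2 (f b) (W a) p) ->
  forall a, W a = 0.
Proof.
move=> h a; have [->|a0] := eqVneq a 0; first by rewrite linear0.
have hc x y : contract (f x) (W y) = contract (f y) (W x).
  by apply/rowP => j; rewrite !mxE.
have [b b0 ba] := @H2_orthogonal [:: a] isT.
have [c c0 cab] := @H2_orthogonal [:: a; b] isT.
have wedge0 x y : H2_metric x y = 0 -> wedge x y = 0 :> R.
  by move=> /eqP; rewrite /H2_metric mulf_eq0 invr_eq0 pnatr_eq0 orbF => /eqP.
apply: (@clifford_kernel R (f a) (f b) (f c) (W a) (W b) (W c)); last 3 first.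
- exact: hc.
- exact: hc.
- exact: hc.
- by apply: wedge0; rewrite H2_metricC ba// mem_head.
- by apply: wedge0; rewrite H2_metricC cab// mem_head.
- by apply: wedge0; rewrite H2_metricC cab// !inE eqxx orbT.
- by rewrite gt_eqF// f_pos.
- by rewrite gt_eqF// f_pos.
- by rewrite gt_eqF// f_pos.
Qed.

End Orthogonal.

(** * The Lie derivative in a chart *)

Lemma open_setXT (S T : topologicalType) (A : set S) :
  open A -> open (A `*` [set: T]).
Proof.
move=> oA; have -> : A `*` [set: T] = (@fst S T) @^-1` A.
  by apply/funext => z; apply/propext; split => // -[].
by apply: open_comp => // z _; exact: cvg_fst.
Qed.

Section FormLinear.
Variable R : realType.

Definition eval_form (p q : 'rV[R]_4) (w : H2 R) : R^o := form_of_H2 w p q.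

Lemma eval_form_is_linear p q : linear (eval_form p q).
Proof.
by move=> k w v; rewrite /eval_form form_of_H2D form_of_H2Z.
Qed.

HB.instance Definition _ p q :=
  GRing.isLinear.Build R (H2 R) R^o _ (eval_form p q) (eval_form_is_linear p q).

Lemma eval_form_continuous p q : continuous (eval_form p q).
Proof. exact: rV_linear_continuous. Qed.

End FormLinear.

Lemma derive_fst (R : realType) (E1 E2 F : normedModType R) (g : E1 -> F)
    (z v : E1 * E2) : differentiable g z.1 ->
  'D_v (fun z' => g z'.1) z = 'D_(v.1) g z.1.
Proof.
move=> dg.
have cf : continuous (fst : {linear (E1 * E2)%type -> E1}) by move=> ?; exact: cvg_fst.
have df := @linear_differentiable _ _ _ (fst : {linear (E1 * E2)%type -> E1}) z cf.
rewrite (derive_comp v df dg).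
by rewrite (@derive_linear _ _ _ (fst : {linear (E1 * E2)%type -> E1}) z v cf).
Qed.

Lemma derive_form_fst (R : realType) (E1 E2 : normedModType R) (g : E1 -> H2 R)
    (z v : E1 * E2) p q :
  differentiable g z.1 ->
  'D_v (fun z' => form_of_H2 (g z'.1) p q : R^o) z = form_of_H2 ('D_(v.1) g z.1) p q.
Proof.
move=> dg; have ce := @eval_form_continuous R p q.
have de := @linear_differentiable _ _ _ (eval_form p q) (g z.1) ce.
have dge : differentiable (eval_form p q \o g) z.1 by exact: differentiable_comp.
rewrite (@derive_fst _ _ _ _ (eval_form p q \o g) z v dge).
by rewrite (derive_comp _ dg de) derive_linear.
Qed.

(** The derivative along a variable field is a sum of products over the basis; Leibniz gives the two
    terms, and the symmetry of second derivatives moves [a] inside in the second one. *)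
Lemma derive_along (R : realType) n m (O : set 'rV[R]_n) (f : 'rV[R]_n -> 'rV[R]_m)
    (V : 'rV[R]_n -> 'rV[R]_n) y a : open O -> O y -> C_on 2 O f ->
  differentiable V y ->
  'D_a (fun z => 'D_(V z) f z) y = 'D_('D_a V y) f y + 'D_(V y) ('D_a f) y.
Proof.
move=> oO Oy Cf dV.
pose e i := basis_vec R (i : 'I_n).
have df z : O z -> differentiable f z by exact: Cf.1.
have ddf v : differentiable ('D_v f) y by exact: (Cf.2 v).1.
have E : 'D_a (fun z => 'D_(V z) f z) y =
         'D_a (\sum_i (fun z => (V z) ord0 i *: 'D_(e i) f z)) y.
  apply: near_eq_derive; apply: filterS (open_nbhs_nbhs (conj oO Oy)) => z Oz.
  by rewrite fct_sumE; apply: derive_basis; exact: df.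
have dVi i : differentiable (fun z => (V z) ord0 i : R^o) y.
  exact: differentiable_mxcoord.
apply: (etrans E).
have dterm i : derivable (fun z => (V z) ord0 i *: 'D_(e i) f z) y a.
  by apply/diff_derivable/differentiable_scale; [exact: dVi|exact: ddf].
rewrite (derive_sum dterm).
have T i : 'D_a (fun z => (V z) ord0 i *: 'D_(e i) f z) y =
    ('D_a V y) ord0 i *: 'D_(e i) f y + (V y) ord0 i *: 'D_(e i) ('D_a f) y.
  apply: (etrans (derive_scale a (dVi i) (ddf (e i)))).
  by rewrite -(derive_mxcoord _ _ _ dV) (derive_comm a (e i) oO Oy Cf).
rewrite (eq_bigr _ (fun i _ => T i)) big_split.
by rewrite (derive_basis _ (df y Oy)) (derive_basis _ (ddf a)).
Qed.

Section Inl.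
Variable R : realType.

Definition inl_model (y : 'rV[R]_3) : ('rV[R]_3 * 'rV[R]_4)%type := (y, 0).

Lemma inl_model_is_linear : linear inl_model.
Proof. by move=> k x y; congr pair; rewrite /= scaler0 addr0. Qed.

HB.instance Definition _ := GRing.isLinear.Build R 'rV[R]_3
  ('rV[R]_3 * 'rV[R]_4)%type _ inl_model inl_model_is_linear.

End Inl.

Section LieChart.
Variables (R : realType) (B : oriented_manifold R 3) (u : B -> H2 R).
Variables (U : vector_field B) (lambda : B * T4 R -> R).
Hypothesis u_immersion : is_immersion u.
Hypothesis g_positive : positive_definite_metric u.
Hypothesis U_T4 : commutes_with_T4 U.
Hypothesis U_phi : lie_equation u U lambda.
Variable c : chart B 'rV[R]_3.
Hypothesis ac : atlas c.

Let O := cimg c.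
Let f : 'rV[R]_3 -> H2 R := u \o cinv c.

(** Reading the field at the zero class of the fibre loses nothing, because it commutes with
    translations ([field_Xparam]). *)
Definition field_at (y : 'rV[R]_3) : Xmodel R := vcomp U c (cinv c y, 0).

Lemma cimg_is_open : open O.
Proof. exact: cimg_open. Qed.

Lemma cimg_cdom y : O y -> cdom c (cinv c y).
Proof. by move=> [b cb <-]; rewrite cmapK. Qed.

Lemma cinvK y : O y -> cmap c (cinv c y) = y.
Proof. by move=> [b cb <-]; rewrite cmapK. Qed.

Lemma immersion_smooth k : C_on k O f.
Proof. exact: (u_immersion.1 c ac k). Qed.

Lemma immersion_diff y : O y -> differentiable f y.
Proof. exact: (immersion_smooth 1).1. Qed.

Lemma field_Xparam z : O z.1 -> (vcomp U c \o Xparam c) z = field_at z.1.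
Proof.
move=> Oz; rewrite /= /field_at /Xparam -[T4_class z.2]add0r.
by rewrite U_T4//; exact: cimg_cdom.
Qed.

Lemma field_smooth k : C_on k O field_at.
Proof.
pose L : {linear 'rV[R]_3 -> ('rV[R]_3 * 'rV[R]_4)%type} := @inl_model R.
have cL : continuous L by exact: rV_linear_continuous.
have oX : open (O `*` [set: 'rV[R]_4]).
  by apply: open_setXT; exact: cimg_is_open.
have C1 := @C_on_comp_linear _ _ _ _ k _ _ L oX cL (vcomp_smooth U ac k).
have -> : O = L @^-1` (O `*` setT) by apply/seteqP; split => // y [].
apply: (C_on_ext _ _ C1); first by apply: open_comp => // y _; exact: cL.
by move=> y; rewrite inE => -[Oy _]; rewrite field_Xparam.
Qed.

Let V y := (field_at y).1.
Let W y := (field_at y).2.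

Lemma fieldV_smooth k : C_on k O V.
Proof.
apply: (@C_on_linear_comp _ _ _ _ k O field_at (fst : {linear Xmodel R -> 'rV[R]_3})).
- exact: cimg_is_open.
- by move=> ?; exact: cvg_fst.
- exact: field_smooth.
Qed.

Lemma fieldW_smooth k : C_on k O W.
Proof.
apply: (@C_on_linear_comp _ _ _ _ k O field_at (snd : {linear Xmodel R -> 'rV[R]_4})).
- exact: cimg_is_open.
- by move=> ?; exact: cvg_snd.
- exact: field_smooth.
Qed.

Lemma derive_field_at y a : O y -> 'D_a field_at y = ('D_a V y, 'D_a W y).
Proof.
move=> Oy; have dF := (field_smooth 1).1 y Oy.
have dV := (fieldV_smooth 1).1 y Oy; have dW := (fieldW_smooth 1).1 y Oy.
have -> : field_at = fun y => (V y, W y).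
  by apply/funext => z; rewrite /V /W; case: (field_at z).
rewrite deriveE; last exact: differentiable_pair.
by rewrite diff_pair//= !deriveE.
Qed.

Lemma near_model (z : Xmodel R) (P : Xmodel R -> Prop) : O z.1 ->
  (forall z', O z'.1 -> P z') -> \near z, P z.
Proof.
move=> Oz h; have oX : open (O `*` [set: 'rV[R]_4]).
  by apply: open_setXT; exact: cimg_is_open.
by apply: filterS (open_nbhs_nbhs (conj oX (conj Oz I))) => z' [Oz' _]; exact: h.
Qed.

Lemma derive_field (z v : Xmodel R) : O z.1 ->
  'D_v (vcomp U c \o Xparam c) z = ('D_(v.1) V z.1, 'D_(v.1) W z.1).
Proof.
move=> Oz.
have E : 'D_v (vcomp U c \o Xparam c) z = 'D_v (fun z' => field_at z'.1) z.
  by apply: near_eq_derive; apply: near_model => // z'; exact: field_Xparam.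
rewrite E derive_fst; last exact: (field_smooth 1).1.
exact: derive_field_at.
Qed.

Lemma dvol_eq0 z v1 v2 v3 : [\/ v1.1 = 0, v2.1 = 0 | v3.1 = 0] ->
  dvol u c z v1 v2 v3 = 0.
Proof. by move=> h; rewrite /dvol e3_eq0// mulr0. Qed.

(** The vertical argument kills [dvol], and the third term of the exterior derivative differentiates
    along the fibre a quantity depending only on the base. *)
Lemma phi_vert z a r b s p : O z.1 ->
  phi u c z (a, r) (b, s) (0, p) =
  form_of_H2 ('D_a f z.1) s p - form_of_H2 ('D_b f z.1) r p.
Proof.
move=> Oz; rewrite /phi dvol_eq0; last by apply: Or33.
rewrite add0r /ext_deriv2 /u_form.
have D (v : Xmodel R) p' q' :
    'D_v (fun z' => form_of_H2 (u (cinv c z'.1)) p' q' : R^o) z =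
    form_of_H2 ('D_(v.1) f z.1) p' q'.
  exact: (@derive_form_fst _ _ _ f z v p' q' (immersion_diff Oz)).
rewrite (D (a, r)) (D (b, s)) (D (0, p))/= derive0.
by rewrite -(scale0r (0 : H2 R)) form_of_H2Z mul0r addr0.
Qed.

Lemma derive_fieldE y x a r : O y ->
  'D_(a, r) (vcomp U c \o Xparam c) (y, x) = ('D_a V y, 'D_a W y).
Proof. exact: (@derive_field (y, x) (a, r)). Qed.

Lemma derive_field_fiber y x r : O y ->
  'D_(0, r) (vcomp U c \o Xparam c) (y, x) = (0, 0).
Proof.
move=> Oy; apply: (etrans (derive_fieldE x 0 r Oy)).
by congr pair; exact: derive0.
Qed.

Lemma phi_vertE y x a r b s p : O y ->
  phi u c (y, x) (a, r) (b, s) (0, p) =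
  form_of_H2 ('D_a f y) s p - form_of_H2 ('D_b f y) r p.
Proof. exact: (@phi_vert (y, x)). Qed.

Lemma form_of_H2_0 x p : form_of_H2 (0 : H2 R) x p = 0.
Proof. by rewrite -(scale0r (0 : H2 R)) form_of_H2Z mul0r. Qed.

(** The field has zero derivative in the fibre directions, so only its derivative along [a]
    contributes, through its horizontal part. Both sides become two-forms evaluated on arbitrary [p]
    and [q], hence equal elements of H^2. *)
Lemma lie_vertical y x a : O y ->
  'D_(V y) ('D_a f) y + 'D_('D_a V y) f y = lambda (Xparam c (y, x)) *: 'D_a f y.
Proof.
move=> Oy; apply: form_of_H2_inj => p q.
have := U_phi ac (z := (y, x)) Oy (a, 0) (0, p) (0, q).
rewrite /lie_deriv3 (field_Xparam (z := (y, x)) Oy).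
rewrite (derive_fieldE x a 0 Oy) (derive_field_fiber x p Oy) (derive_field_fiber x q Oy).
have E : 'D_(field_at y) (fun z' => phi u c z' (a, 0) (0, p) (0, q) : R^o) (y, x) =
   form_of_H2 ('D_(V y) ('D_a f) y) p q.
  have E1 : 'D_(field_at y) (fun z' => phi u c z' (a, 0) (0, p) (0, q) : R^o) (y, x) =
    'D_(field_at y) (fun z' => form_of_H2 ('D_a f z'.1) p q : R^o) (y, x).
    apply: near_eq_derive; apply: near_model => // z' Oz'.
    rewrite (phi_vert _ _ _ _ _ Oz') derive0.
    by move: ('D_a f _) => A1; rewrite form_of_H2_0 subr0.
  apply: (etrans E1).
  exact: (@derive_form_fst _ _ _ ('D_a f) (y, x) (field_at y) p q
    (((immersion_smooth 2).2 a).1 y Oy)).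
have d0 : dvol u c (y, x) (a, 0) (0, p) (0, q) = 0 by apply: dvol_eq0; apply: Or32.
rewrite E !(phi_vertE _ _ _ _ _ _ Oy) d0 derive0.
move: ('D_(V y) ('D_a f) y) ('D_('D_a V y) f y) ('D_a f y) => A1 A2 A3.
move: ('D_a W y) (lambda _) => A4 l.
rewrite !form_of_H2_0l !form_of_H2_0r !form_of_H2_0 form_of_H2D form_of_H2Z.
by rewrite mulr0 !subr0 !addr0.
Qed.

(** On two horizontal vectors and a vertical one [phi] vanishes identically, so the right-hand side
    and the derivative of [phi] along the field drop out; only the terms where [W] is differentiated
    survive. *)
Lemma lie_mixed y a b p : O y ->
  form_of_H2 ('D_a f y) ('D_b W y) p = form_of_H2 ('D_b f y) ('D_a W y) p.
Proof.
move=> Oy.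
have := U_phi ac (z := (y, 0)) Oy (a, 0) (b, 0) (0, p).
rewrite /lie_deriv3 (field_Xparam (z := (y, 0)) Oy).
rewrite (derive_fieldE 0 a 0 Oy) (derive_fieldE 0 b 0 Oy) (derive_field_fiber 0 p Oy).
have E : 'D_(field_at y) (fun z' => phi u c z' (a, 0) (b, 0) (0, p) : R^o) (y, 0) = 0.
  have E1 : 'D_(field_at y) (fun z' => phi u c z' (a, 0) (b, 0) (0, p) : R^o) (y, 0) =
    'D_(field_at y) (cst (0 : R^o)) (y, 0).
    apply: near_eq_derive; apply: near_model => // z' Oz'.
    rewrite (phi_vert _ _ _ _ _ Oz').
    by move: ('D_a f _) ('D_b f _) => A1 A2; rewrite !form_of_H2_0l subr0.
  by apply: (etrans E1); exact: derive_cst.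
have d0 : dvol u c (y, 0) (a, 0) (b, 0) (0, p) = 0 by apply: dvol_eq0; apply: Or33.
rewrite E !(phi_vertE _ _ _ _ _ _ Oy) d0.
move: ('D_('D_a V y) f y) ('D_('D_b V y) f y) ('D_a f y) ('D_b f y) => A1 A2 A3 A4.
move: ('D_a W y) ('D_b W y) (lambda _) => A5 A6 l.
rewrite !form_of_H2_0l !(subr0, addr0, mulr0, add0r, sub0r).
by move=> /eqP; rewrite addrC subr_eq0 => /eqP.
Qed.

Lemma derive_stretch y x a : O y ->
  'D_a (fun z => 'D_(V z) f z) y = lambda (Xparam c (y, x)) *: 'D_a f y.
Proof.
move=> Oy; rewrite -lie_vertical// addrC.
apply: (derive_along a cimg_is_open Oy (immersion_smooth 2)).
exact: (fieldV_smooth 1).1.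
Qed.

Lemma derive_fieldW y a : O y -> 'D_a W y = 0.
Proof.
move=> Oy.
pose fl : {linear 'rV[R]_3 -> H2 R} := 'd f y.
pose Wl : {linear 'rV[R]_3 -> 'rV[R]_4} := 'd W y.
have fE v : 'D_v f y = fl v by rewrite deriveE//; exact: immersion_diff.
have WE v : 'D_v W y = Wl v by rewrite deriveE//; exact: (fieldW_smooth 1).1.
rewrite WE; apply: (@clifford_linear R fl) => [v v0|v w p].
  by rewrite -fE; exact: (g_positive ac Oy v0).
by rewrite -!fE -!WE; exact: lie_mixed.
Qed.

End LieChart.

(** * Constancy of the stretching factor and of the fibre component *)

Lemma cst_on_ball_scalar (R : realType) (E : normedModType R) (g : E -> R^o) x0 r :
  (forall x, ball x0 r x -> differentiable g x) ->
  (forall x v, ball x0 r x -> 'D_v g x = 0) ->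
  forall x y, ball x0 r x -> ball x0 r y -> g x = g y.
Proof.
move=> dg Dg x y bx by_; apply/esym/eqP; rewrite -subr_eq0.
have [|t t01] := @mean_value _ _ g x (y - x).
  by move=> t t01; apply: dg; exact: ball_segment.
by rewrite subrKC => ->; rewrite Dg//; exact: ball_segment.
Qed.

Lemma scale_cancel (R : fieldType) (M : lmodType R) (k k' : R) (v : M) :
  v != 0 -> k *: v = k' *: v -> k = k'.
Proof.
move=> v0 /eqP; rewrite -subr_eq0 -scalerBl scaler_eq0 (negbTE v0) orbF.
by rewrite subr_eq0 => /eqP.
Qed.

Lemma add_scale_cancel (R : pzRingType) (M : lmodType R) (k : R) (x y v w : M) :
  v = w -> x + k *: v = y + k *: w -> x = y.
Proof. by move=> ->; exact: addIr. Qed.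

Lemma metric_cancel (R : realType) (v w : H2 R) (k l : R) :
  0 < H2_metric v v -> H2_metric w v = 0 -> k *: v = l *: w -> k = 0.
Proof.
move=> v0 wv /(congr1 (fun t => H2_metric t v)); rewrite !H2_metricZl wv mulr0.
by move=> /eqP; rewrite mulf_eq0 (gt_eqF v0) orbF => /eqP.
Qed.

Section Constancy.
Variables (R : realType) (B : oriented_manifold R 3) (u : B -> H2 R).
Variables (U : vector_field B) (lambda : B * T4 R -> R).
Hypothesis u_immersion : is_immersion u.
Hypothesis g_positive : positive_definite_metric u.
Hypothesis U_T4 : commutes_with_T4 U.
Hypothesis U_phi : lie_equation u U lambda.
Variable c : chart B 'rV[R]_3.
Hypothesis ac : atlas c.

Let O := cimg c.
Let f : 'rV[R]_3 -> H2 R := u \o cinv c.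
Let V y := (field_at U c y).1.
Let W y := (field_at U c y).2.
Let lam y := lambda (Xparam c (y, 0)).
Let h y := 'D_(V y) f y.

Lemma metric_gt0 y a : O y -> a != 0 -> 0 < H2_metric ('D_a f y) ('D_a f y).
Proof. by move=> Oy; exact: g_positive. Qed.

Lemma derive_neq0 y a : O y -> a != 0 -> 'D_a f y != 0.
Proof.
move=> Oy /(metric_gt0 Oy); apply: contraTneq => ->.
by rewrite H2_metric0l ltxx.
Qed.

Lemma basis0_neq0 : basis_vec R (ord0 : 'I_3) != 0.
Proof.
apply/eqP => /rowP/(_ ord0); rewrite !mxE !eqxx/= => /eqP.
by rewrite oner_eq0.
Qed.

(** In [derive_stretch] only the factor [lambda] depends on the fibre point, and it multiplies a
    nonzero vector. *)
Lemma lambda_fiber b t : cdom c b -> lambda (b, t) = lambda (b, 0).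
Proof.
move=> cb; have Oy : O (cmap c b) by exists b.
have P (s : T4 R) : Xparam c (cmap c b, repr s) = (b, s).
  by rewrite /Xparam/= cmapK// /T4_class reprK.
have e x := derive_stretch u_immersion U_T4 U_phi ac x (basis_vec R ord0) Oy.
have := scale_cancel (derive_neq0 Oy basis0_neq0)
  (etrans (esym (e (repr t))) (e (repr (0 : T4 R)))).
by rewrite (P t) (P 0).
Qed.

Lemma derive_stretchE y a : O y -> 'D_a h y = lam y *: 'D_a f y.
Proof. by move=> Oy; exact: (derive_stretch u_immersion U_T4 U_phi ac 0 a Oy). Qed.

Lemma stretch_smooth k : C_on k O h.
Proof.
have Cf := immersion_smooth u_immersion ac; have CV := fieldV_smooth U_T4 ac.
have oO : open O by exact: cimg_is_open.
have C1 : C_on k O (fun z => \sum_i (V z) ord0 i *: 'D_(basis_vec R i) f z).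
  apply: C_on_sum => // i _; apply: (C_on_scale oO); last exact: ((Cf k.+1).2 _).
  exact: C_on_mxcoord.
apply: (C_on_ext oO _ C1) => z; rewrite inE => Oz; apply/esym.
by apply: derive_basis; exact: (Cf 1).1.
Qed.

(** The function [lambda] comes with no regularity. It is recovered as a quotient of metric products
    from [dh = lambda df], whose denominator is positive. *)
Lemma lambda_smooth : C_on 1 O lam.
Proof.
have oO : open O by exact: cimg_is_open.
pose e0 := basis_vec R (ord0 : 'I_3).
have Ch : C_on 1 O ('D_e0 h) by exact: (stretch_smooth 2).2.
have Cf : C_on 1 O ('D_e0 f) by exact: (immersion_smooth u_immersion ac 2).2.
have Cn := C_on_bilinear (@H2_metric_continuous R) oO Ch Cf.
have Cd := C_on_bilinear (@H2_metric_continuous R) oO Cf Cf.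
have d0 z : O z -> H2_metric ('D_e0 f z) ('D_e0 f z) != 0.
  by move=> Oz; rewrite gt_eqF// (metric_gt0 Oz basis0_neq0).
apply: (C_on_ext oO _ (C_onM oO Cn (C_onV oO d0 Cd))) => z; rewrite inE => Oz.
rewrite (derive_stretchE e0 Oz).
have := d0 z Oz; move: ('D_e0 f z) => A A0.
by rewrite /= H2_metricZl mulfK.
Qed.

(** Differentiating [dh = lambda df] once more and cancelling the symmetric second derivatives
    leaves [sym]. For [a] with [D_a f] orthogonal to [D_b f], pairing with [D_a f] isolates the
    derivative of [lambda] along [b]. *)
Lemma derive_lambda y b : O y -> 'D_b lam y = 0.
Proof.
move=> Oy; have oO : open O by exact: cimg_is_open.
have Cf := immersion_smooth u_immersion ac 2.
have Cl := lambda_smooth.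
have D2 v w : 'D_v ('D_w h) y = 'D_v lam y *: 'D_w f y + lam y *: 'D_v ('D_w f) y.
  have E : 'D_v ('D_w h) y = 'D_v (fun z => lam z *: 'D_w f z) y.
    apply: near_eq_derive; apply: filterS (open_nbhs_nbhs (conj oO Oy)) => z.
    exact: derive_stretchE.
  apply: (etrans E); apply: (derive_scale v (Cl.1 y Oy)).
  exact: (Cf.2 w).1.
have sym v w : 'D_v lam y *: 'D_w f y = 'D_w lam y *: 'D_v f y.
  have hc := derive_comm v w oO Oy (stretch_smooth 2).
  have fc := derive_comm v w oO Oy Cf.
  exact: (add_scale_cancel fc (etrans (esym (D2 v w)) (etrans hc (D2 w v)))).
have df := immersion_diff u_immersion ac Oy.
have [a a0 /(_ b (mem_head _ _)) ab] := @H2_orthogonal R ('d f y) [:: b] isT.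
rewrite -!(deriveE _ df) in ab.
rewrite H2_metricC in ab.
exact: (metric_cancel (metric_gt0 Oy a0) ab (sym b a)).
Qed.

Lemma lambda_near y : O y -> exists2 r : R, 0 < r &
  forall y', ball y r y' -> O y' -> lam y' = lam y.
Proof.
move=> Oy; have oO : open O by exact: cimg_is_open.
have [r /= r0 rO] := (nbhs_ballP y _).1 (open_nbhs_nbhs (conj oO Oy)).
exists r => // y' by' _; apply: (@cst_on_ball_scalar _ _ lam y r) => //.
- by move=> x /rO; exact: lambda_smooth.1.
- by move=> x v /rO; exact: derive_lambda.
- exact: ballxx.
Qed.

Lemma fieldW_near y : O y -> exists2 r : R, 0 < r &
  forall y', ball y r y' -> O y' -> W y' = W y.
Proof.
move=> Oy; have oO : open O by exact: cimg_is_open.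
have [r /= r0 rO] := (nbhs_ballP y _).1 (open_nbhs_nbhs (conj oO Oy)).
exists r => // y' by' _; apply: (@cst_on_ball _ _ _ W y r) => //.
- by move=> x /rO; exact: (fieldW_smooth U_T4 ac 1).1.
- by move=> x v /rO; exact: (derive_fieldW u_immersion g_positive U_T4 U_phi ac v).
- exact: ballxx.
Qed.

Lemma center_near l y : (forall p, lambda p = l) -> l != 0 -> O y ->
  exists2 r : R, 0 < r &
  forall y', ball y r y' -> O y' -> l^-1 *: h y' - f y' = l^-1 *: h y - f y.
Proof.
move=> ll l0 Oy; have oO : open O by exact: cimg_is_open.
have [r /= r0 rO] := (nbhs_ballP y _).1 (open_nbhs_nbhs (conj oO Oy)).
have dh x : O x -> differentiable h x by exact: (stretch_smooth 1).1.
have df x : O x -> differentiable f x by exact: (immersion_diff u_immersion ac).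
have dlh x : O x -> differentiable (l^-1 *: h) x.
  by move=> /dh; exact: differentiableZ.
have dk x : ball y r x -> differentiable (l^-1 *: h - f) x.
  by move=> /rO Ox; apply: differentiableB; [exact: dlh|exact: df].
have Dk x v : ball y r x -> 'D_v (l^-1 *: h - f) x = 0.
  move=> /rO Ox.
  have DB : 'D_v (l^-1 *: h - f) x = 'D_v (l^-1 *: h) x - 'D_v f x.
    by apply: deriveB; apply: diff_derivable; [exact: dlh|exact: df].
  apply: (etrans DB).
  have Dh := etrans (deriveZ l^-1 (diff_derivable (v := v) (dh x Ox)))
    (congr1 ( *:%R l^-1) (derive_stretchE v Ox)).
  apply: (etrans (congr1 (fun w => w - 'D_v f x) Dh)).
  by rewrite /lam ll; move: ('D_v f x) => A; rewrite scalerA mulVf// scale1r subrr.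
exists r; first exact: r0.
by move=> y' by' _; exact: (cst_on_ball dk Dk by' (ballxx y r0)).
Qed.

End Constancy.

(** * From charts to the manifold *)

Section Chart.
Variables (R : realType) (M : topologicalType) (E : normedModType R).
Variable c : chart M E.

Lemma cmap_continuous_at b : cdom c b -> {for b, continuous (cmap c)}.
Proof.
move=> cb; have : {within cdom c, continuous (cmap c)} by exact: cmap_continuous.
rewrite continuous_open_subspace; last exact: cdom_open.
by apply; rewrite inE.
Qed.

Lemma cinv_continuous_at y : cimg c y -> {for y, continuous (cinv c)}.
Proof.
move=> cy; have : {within cimg c, continuous (cinv c)} by exact: cinv_continuous.
rewrite continuous_open_subspace; last exact: cimg_open.
by apply; rewrite inE.
Qed.

Lemma open_chart_image (A : set M) : open A -> open (cmap c @` (cdom c `&` A)).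
Proof.
move=> oA.
have -> : cmap c @` (cdom c `&` A) = cimg c `&` cinv c @^-1` A.
  apply/seteqP; split => [_ [b [cb Ab] <-]|_ [[b cb <-] /= Ab]].
    by split; [exists b|rewrite /= cmapK].
  by exists b => //; split => //; rewrite cmapK in Ab.
rewrite openE => y [cy Ay]; apply: filterI.
  by apply: open_nbhs_nbhs; split => //; exact: cimg_open.
by apply: (cinv_continuous_at cy); exact: open_nbhs_nbhs.
Qed.

End Chart.

(** Chart balls pull back to neighbourhoods, so each level set of [F] is both open and closed. *)
Lemma locally_constant (R : realType) (B : oriented_manifold R 3) (T : Type)
    (F : B -> T) : connected [set: B] ->
  (forall c, atlas c -> forall y, cimg c y -> exists2 r : R, 0 < r &
     forall y', ball y r y' -> cimg c y' -> F (cinv c y') = F (cinv c y)) ->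
  forall b b', F b = F b'.
Proof.
move=> cB loc b0.
have near_cst b : \forall b' \near b, F b' = F b.
  have [c ac cb] := atlas_cover b.
  have Oy : cimg c (cmap c b) by exists b.
  have [r r0 rP] := loc c ac _ Oy.
  have nb : nbhs b (cmap c @^-1` ball (cmap c b) r).
    by apply: (cmap_continuous_at cb); exact: nbhsx_ballx.
  have nd : nbhs b (cdom c) by apply: open_nbhs_nbhs; split => //; exact: cdom_open.
  apply: filterS2 nb nd => b' bb' cb'.
  have := rP _ bb' (ex_intro2 _ _ b' cb' erefl).
  by rewrite !cmapK.
pose A : set B := [set b | F b = F b0].
have oA : open A.
  rewrite openE => b Ab; apply: filterS (near_cst b) => b' e.
  by rewrite /A/= e.
have cA : closed A.
  rewrite -openC openE => b nAb; apply: filterS (near_cst b) => b' e Ab'.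
  by apply: nAb; rewrite /A/= -e.
have AT : A = [set: B].
  by apply: cB; [exists b0|exists A => //; rewrite setTI|exists A => //; rewrite setTI].
by move=> b'; have : A b' by rewrite AT.
Qed.

Section Global.
Variables (R : realType) (B : oriented_manifold R 3) (u : B -> H2 R).
Variables (U : vector_field B) (lambda : B * T4 R -> R).
Hypothesis B_connected : connected [set: B].
Hypothesis u_immersion : is_immersion u.
Hypothesis g_positive : positive_definite_metric u.
Hypothesis U_T4 : commutes_with_T4 U.
Hypothesis U_phi : lie_equation u U lambda.

Lemma vcomp_fiber c (p : B * T4 R) : atlas c -> cdom c p.1 ->
  vcomp U c p = vcomp U c (p.1, 0).
Proof. by case: p => b t ac cb; rewrite -[t]add0r U_T4. Qed.

Lemma lambda_global p p' : lambda p = lambda p'.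
Proof.
have fib q : lambda q = lambda (q.1, 0).
  case: q => b t; have [c ac cb] := atlas_cover b.
  exact: (lambda_fiber u_immersion g_positive U_T4 U_phi ac t cb).
rewrite fib [RHS]fib.
apply: (@locally_constant _ _ _ (fun b => lambda (b, 0)) B_connected) => c ac y Oy.
have [r r0 rP] := lambda_near u_immersion g_positive U_T4 U_phi ac Oy.
exists r => // y' by' Oy'; have := rP y' by' Oy'.
by rewrite fib [in RHS]fib.
Qed.

Definition chart_at (b : B) : chart B 'rV[R]_3 := s2val (cid2 (atlas_cover b)).

Lemma chart_at_atlas b : atlas (chart_at b).
Proof. exact: (s2valP (cid2 (atlas_cover b))). Qed.

Lemma chart_at_cdom b : cdom (chart_at b) b.
Proof. exact: (s2valP' (cid2 (atlas_cover b))). Qed.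

Definition fiber_part (b : B) : 'rV[R]_4 := (vcomp U (chart_at b) (b, 0)).2.

Lemma fiber_partE c b : atlas c -> cdom c b -> fiber_part b = (vcomp U c (b, 0)).2.
Proof.
move=> ac cb; have ad := chart_at_atlas b; have db := chart_at_cdom b.
by rewrite /fiber_part (vcomp_transition U ac ad (p := (b, 0)) cb db).
Qed.

Lemma fiber_part_global b b' : fiber_part b = fiber_part b'.
Proof.
apply: (locally_constant B_connected) => c ac y Oy.
have [r r0 rP] := fieldW_near u_immersion g_positive U_T4 U_phi ac Oy.
exists r => // y' by' Oy'; have := rP y' by' Oy'.
by rewrite -!(fiber_partE ac)//; exact: cimg_cdom.
Qed.

(** The vector u_*(V) does not depend on the chart: the chain rule for the transition map matches
    the transformation law of [vcomp]. *)
Lemma derive_chart c d b : atlas c -> atlas d -> cdom c b -> cdom d b ->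
  'D_((vcomp U c (b, 0)).1) (u \o cinv c) (cmap c b) =
  'D_((vcomp U d (b, 0)).1) (u \o cinv d) (cmap d b).
Proof.
move=> ac ad cb db.
have oS : open (cmap c @` (cdom c `&` cdom d)).
  by apply: open_chart_image; exact: cdom_open.
have Sb : (cmap c @` (cdom c `&` cdom d)) (cmap c b) by exists b.
have dt : differentiable (transition c d) (cmap c b).
  by apply: ((atlas_compatible ac ad).1 1%N).1.
have tb : transition c d (cmap c b) = cmap d b by rewrite /transition/= cmapK.
have du : differentiable (u \o cinv d) (transition c d (cmap c b)).
  by rewrite tb; apply: (immersion_diff u_immersion ad); exists b.
have E : 'D_((vcomp U c (b, 0)).1) (u \o cinv c) (cmap c b) =
    'D_((vcomp U c (b, 0)).1) ((u \o cinv d) \o transition c d) (cmap c b).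
  apply: near_eq_derive; apply: filterS (open_nbhs_nbhs (conj oS Sb)).
  by move=> _ [b' [cb' db'] <-]; rewrite /transition/= cmapK// cmapK.
apply: (etrans E); apply: (etrans (derive_comp _ dt du)).
by rewrite tb (vcomp_transition U ac ad (p := (b, 0)) cb db).
Qed.

Lemma center_global l : (forall p, lambda p = l) -> l != 0 ->
  exists c0 : H2 R, forall c, atlas c -> forall b, cdom c b ->
    'D_((vcomp U c (b, 0)).1) (u \o cinv c) (cmap c b) = l *: (u b + c0).
Proof.
move=> ll l0.
(* The candidate translation is u_*(V) / l - u, computed at each point in a chosen chart; [ctrE]
   removes the choice. *)
pose ctr (b : B) := l^-1 *: 'D_((vcomp U (chart_at b) (b, 0)).1)
  (u \o cinv (chart_at b)) (cmap (chart_at b) b) - u b.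
have ctrE c b : atlas c -> cdom c b -> ctr b =
    l^-1 *: 'D_((vcomp U c (b, 0)).1) (u \o cinv c) (cmap c b) - u b.
  move=> ac cb; rewrite /ctr.
  by rewrite (derive_chart (chart_at_atlas b) ac (chart_at_cdom b) cb).
have ctr_cst b b' : ctr b = ctr b'.
  apply: (locally_constant B_connected) => c ac y Oy.
  have [r r0 rP] := center_near u_immersion U_T4 U_phi ac ll l0 Oy.
  exists r => // y' by' Oy'; have := rP y' by' Oy'.
  have cE z : cimg c z -> ctr (cinv c z) =
      l^-1 *: 'D_((field_at U c z).1) (u \o cinv c) z - (u \o cinv c) z.
    move=> Oz; rewrite (ctrE c _ ac (cimg_cdom Oz)).
    by rewrite (cinvK Oz).
  by rewrite -(cE _ Oy) -(cE _ Oy').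
have [[b0 _]|noB] := pselect (exists b : B, True); last first.
  by exists 0 => c _ b; exfalso; apply: noB; exists b.
exists (ctr b0) => c ac b cb; rewrite -(ctr_cst b) (ctrE c b ac cb) addrC subrK.
by rewrite scalerA divff// scale1r.
Qed.

End Global.

(** * Cone coordinates in a chart *)

(** Four vectors of R^3 satisfy a nontrivial linear relation; pairing its image with each [f (s i)]
    kills every coefficient. *)
Lemma orthogonal_family (R : realType) (f : {linear 'rV[R]_3 -> H2 R})
    (s : 'I_4 -> 'rV[R]_3) :
  (forall i, H2_metric (f (s i)) (f (s i)) != 0) ->
  (forall i j, i != j -> H2_metric (f (s i)) (f (s j)) = 0) -> False.
Proof.
move=> s0 sij.
have [k k0 kM] := @orthogonal_exists R 4 3 (\matrix_(i, j) s i ord0 j) isT.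
have sumE : \sum_i k ord0 i *: s i = 0.
  apply/rowP => j; rewrite summxE mxE.
  have := congr1 (fun A : 'rV[R]_3 => A ord0 j) kM; rewrite !mxE => e.
  by rewrite -[RHS]e; apply: eq_bigr => i _; rewrite !mxE.
move/eqP: k0; apply; apply/rowP => i; rewrite mxE.
have := congr1 (fun v => H2_metric (f v) (f (s i))) sumE.
rewrite linear_sum linear0 H2_metric0l.
under eq_bigr do rewrite linearZ/=.
rewrite H2_metric_suml (bigD1 i)//= big1 => [|j ji]; last by rewrite sij// mulr0.
by rewrite addr0 => /eqP; rewrite mulf_eq0 (negbTE (s0 i)) orbF => /eqP.
Qed.

Lemma scale_add0 (R : pzRingType) (M : lmodType R) (k : R) (x y : M) :
  k = 0 -> k *: x + y = y.
Proof. by move=> ->; rewrite scale0r add0r. Qed.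

Section Cone.
Variables (R : realType) (O : set 'rV[R]_3) (f : 'rV[R]_3 -> H2 R).
Variables (V : 'rV[R]_3 -> 'rV[R]_3) (l : R) (y0 : 'rV[R]_3).
Hypothesis oO : open O.
Hypothesis Cf : smooth_on O f.
Hypothesis f_pos : forall y, O y -> forall a, a != 0 ->
  0 < H2_metric ('D_a f y) ('D_a f y).
Hypothesis l0 : l != 0.
Hypothesis DV : forall y, O y -> 'D_(V y) f y = l *: f y.
Hypothesis Oy0 : O y0.
Hypothesis V0 : V y0 != 0.

Let Q (y : 'rV[R]_3) : R^o := H2_metric (f y) (f y).

(** The form on H^2 has signature (3,3), so the position vector may have negative or zero square;
    the radius is smooth and positive only here. *)
Definition cone_dom : set 'rV[R]_3 := O `&` [set y | 0 < Q y].
Definition radius (y : 'rV[R]_3) : R^o := Num.sqrt (Q y).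
Definition direction (y : 'rV[R]_3) : H2 R := (radius y)^-1 *: f y.

Lemma Q_smooth k : C_on k O Q.
Proof. exact: (C_on_bilinear (@H2_metric_continuous R) oO (Cf k) (Cf k)). Qed.

Lemma cone_dom_open : open cone_dom.
Proof.
rewrite openE => y [Oy Qy]; apply: filterI.
  by apply: open_nbhs_nbhs; split.
have cQ : {for y, continuous Q} by exact: (Q_smooth 0).
have n0 : nbhs (Q y) [set t : R^o | 0 < t].
  by apply: open_nbhs_nbhs; split => //; exact: open_gt.
exact: cQ n0.
Qed.

Lemma cone_dom_sub : cone_dom `<=` O.
Proof. by move=> y []. Qed.

(** The vector [l *: f y0] is the image of the nonzero tangent vector [V y0], and the metric is
    positive on tangent vectors. *)
Lemma cone_dom_y0 : cone_dom y0.
Proof.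
split => //=; have := f_pos Oy0 V0; rewrite (DV Oy0).
rewrite H2_metricZl H2_metricZr mulrA pmulr_rgt0//.
by rewrite -expr2 exprn_even_gt0.
Qed.

Lemma radius_gt0 y : cone_dom y -> 0 < radius y.
Proof. by move=> [_ Qy]; rewrite sqrtr_gt0. Qed.

Lemma radius_neq0 y : cone_dom y -> radius y != 0.
Proof. by move=> /radius_gt0 r0; rewrite gt_eqF. Qed.

Lemma radius_smooth k : C_on k cone_dom radius.
Proof.
apply: (C_on_sqrt cone_dom_open); first by move=> y [].
by apply: C_on_sub (Q_smooth k); exact: cone_dom_sub.
Qed.

Lemma direction_smooth k : C_on k cone_dom direction.
Proof.
apply: (C_on_scale cone_dom_open).
  by apply: (C_onV cone_dom_open); [exact: radius_neq0|exact: radius_smooth].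
by apply: C_on_sub (Cf k); exact: cone_dom_sub.
Qed.

Lemma radius_direction y : cone_dom y -> f y = radius y *: direction y.
Proof.
by move=> Oy; rewrite /direction scalerA divff ?scale1r//; exact: radius_neq0.
Qed.

Lemma direction_norm y : cone_dom y -> H2_metric (direction y) (direction y) = 1.
Proof.
move=> Oy; rewrite /direction H2_metricZl H2_metricZr mulrA -invfM.
rewrite -expr2 /radius sqr_sqrtr; last by case: Oy => _ /ltW.
by rewrite mulVf// gt_eqF//; case: Oy.
Qed.

Lemma derive_metric_self (E : normedModType R) (g : E -> H2 R) z v :
  differentiable g z ->
  'D_v (fun z => H2_metric (g z) (g z) : R^o) z = 2 * H2_metric ('D_v g z) (g z).
Proof.
move=> dg.
apply: (etrans (derive_bilinear (@H2_metric_continuous R) v dg dg)).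
move: ('D_v g z) (g z) => A A1; rewrite /= (H2_metricC A1 A).
by rewrite mulr_natl mulr2n.
Qed.

Lemma derive_radius y v : cone_dom y ->
  radius y * 'D_v radius y = H2_metric ('D_v f y) (f y).
Proof.
move=> Oy; have dr := (radius_smooth 1).1 y Oy.
have df := (Cf 1).1 y (cone_dom_sub Oy).
have e : 'D_v (fun z => radius z *: radius z : R^o) y = 'D_v Q y.
  apply: near_eq_derive; apply: filterS (open_nbhs_nbhs (conj cone_dom_open Oy)).
  by move=> z [_ /ltW Qz]; rewrite /radius -[_ *: _]expr2 sqr_sqrtr.
have := etrans (esym (derive_scale v dr dr)) (etrans e (derive_metric_self v df)).
move: ('D_v radius y) ('D_v f y) (radius y) => A B r; rewrite /GRing.scale/=.
lra.
Qed.

Lemma derive_radius_direction y v : cone_dom y ->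
  'D_v f y = 'D_v radius y *: direction y + radius y *: 'D_v direction y.
Proof.
move=> Oy; have dr := (radius_smooth 1).1 y Oy.
have dn := (direction_smooth 1).1 y Oy.
apply: (etrans _ (derive_scale v dr dn)).
apply: near_eq_derive; apply: filterS (open_nbhs_nbhs (conj cone_dom_open Oy)).
exact: radius_direction.
Qed.

Lemma derive_radius_field y : cone_dom y -> 'D_(V y) radius y = l * radius y.
Proof.
move=> Oy; apply: (mulfI (radius_neq0 Oy)); rewrite (derive_radius _ Oy).
have Qy : 0 <= Q y by case: Oy => _ /ltW.
have QE : H2_metric (f y) (f y) = radius y * radius y := esym (sqr_sqrtr Qy).
by rewrite (DV (cone_dom_sub Oy)) H2_metricZl QE mulrCA.
Qed.

(** In the derivative of [radius *: direction] along [V], the radial term already accounts for all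
    of [l *: f]. *)
Lemma derive_direction_field y : cone_dom y -> 'D_(V y) direction y = 0.
Proof.
move=> Oy; have := derive_radius_direction (V y) Oy.
rewrite (derive_radius_field Oy) (DV (cone_dom_sub Oy)).
rewrite {1}(radius_direction Oy) scalerA.
have := radius_neq0 Oy.
move: ('D_(V y) direction y) (direction y) (radius y) => A B r r0.
move=> /eqP; rewrite -[X in X == _]addr0 (inj_eq (addrI _)) eq_sym scaler_eq0.
by rewrite (negbTE r0) => /eqP.
Qed.

Variables (wa wb : H2 R).

(** Two functions constant along [V], serving as coordinates on the surface, and the radius. The
    vectors [wa] and [wb] are chosen in [cone_map_regular]. *)
Definition cone_map (y : 'rV[R]_3) : 'rV[R]_3 :=
  \row_j nth 0 [:: H2_metric (direction y) wa; H2_metric (direction y) wb; radius y] j.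

Lemma cone_mapE y : [/\ cone_map y ord0 (inord 0) = H2_metric (direction y) wa,
  cone_map y ord0 (inord 1) = H2_metric (direction y) wb &
  cone_map y ord0 (inord 2) = radius y].
Proof. by split; rewrite mxE inordK. Qed.

Lemma rV3P (a b : 'rV[R]_3) : a ord0 (inord 0) = b ord0 (inord 0) ->
  a ord0 (inord 1) = b ord0 (inord 1) -> a ord0 (inord 2) = b ord0 (inord 2) -> a = b.
Proof.
move=> e0 e1 e2'; apply/rowP => j; rewrite -[j]inord_val.
by case: j => -[|[|[|j]]].
Qed.

Lemma cone_map_smooth : smooth_on cone_dom cone_map.
Proof.
move=> k; apply: (C_on_mx cone_dom_open) => i j.
have Cm w : C_on k cone_dom (fun y => H2_metric (direction y) w : R^o).
  exact: (C_on_bilinear (@H2_metric_continuous R) cone_dom_open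
    (direction_smooth k) (C_on_cst k cone_dom w)).
have -> : (fun y => cone_map y i j : R^o) = fun y =>
    nth 0 [:: H2_metric (direction y) wa; H2_metric (direction y) wb; radius y] j.
  by apply/funext => y; rewrite mxE.
by case: j => -[|[|[|j]]]//= _; exact: radius_smooth.
Qed.

Lemma derive_cone_map y v : cone_dom y ->
  [/\ ('D_v cone_map y) ord0 (inord 0) = H2_metric ('D_v direction y) wa,
      ('D_v cone_map y) ord0 (inord 1) = H2_metric ('D_v direction y) wb &
      ('D_v cone_map y) ord0 (inord 2) = 'D_v radius y].
Proof.
move=> Oy; have dm := (cone_map_smooth 1).1 y Oy.
have dn := (direction_smooth 1).1 y Oy.
have Dm w : 'D_v (fun y => H2_metric (direction y) w : R^o) y =
    H2_metric ('D_v direction y) w.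
  apply: (etrans (derive_bilinear (@H2_metric_continuous R) v dn
    (differentiable_cst w y))).
  rewrite derive_cst; move: ('D_v direction y) (direction y) => A B /=.
  by rewrite (H2_metricC B) H2_metric0l addr0.
split; rewrite (derive_mxcoord _ _ _ dm).
- apply: (etrans _ (Dm wa)); congr ('D_v _ y).
  by apply/funext => z; have [] := cone_mapE z.
- apply: (etrans _ (Dm wb)); congr ('D_v _ y).
  by apply/funext => z; have [] := cone_mapE z.
- congr ('D_v _ y).
  by apply/funext => z; have [] := cone_mapE z.
Qed.

Lemma derive_cone_map_field y : cone_dom y ->
  [/\ ('D_(V y) cone_map y) ord0 (inord 0) = 0,
      ('D_(V y) cone_map y) ord0 (inord 1) = 0 &
      ('D_(V y) cone_map y) ord0 (inord 2) = l * radius y].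
Proof.
move=> Oy; have [-> -> ->] := derive_cone_map (V y) Oy.
by rewrite (derive_direction_field Oy) (derive_radius_field Oy) !H2_metric0l.
Qed.

End Cone.

Section ConeRegular.
Variables (R : realType) (O : set 'rV[R]_3) (f : 'rV[R]_3 -> H2 R).
Variables (V : 'rV[R]_3 -> 'rV[R]_3) (l : R) (y0 : 'rV[R]_3).
Hypothesis oO : open O.
Hypothesis Cf : smooth_on O f.
Hypothesis f_pos : forall y, O y -> forall a, a != 0 ->
  0 < H2_metric ('D_a f y) ('D_a f y).
Hypothesis l0 : l != 0.
Hypothesis DV : forall y, O y -> 'D_(V y) f y = l *: f y.
Hypothesis Oy0 : O y0.
Hypothesis V0 : V y0 != 0.

(** Take [wa], [wb] to be the images of [a], [b] completing [V y0] to an orthogonal frame. A nonzero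
    [v] in the kernel does not change the radius, so [D_v f] is a multiple of the derivative of the
    direction and is orthogonal to [wa] and [wb]; it is also orthogonal to the position vector, that
    is to the image of [V y0]. This would make four orthogonal vectors in a space of dimension
    three. *)
Lemma cone_map_regular : exists wa wb : H2 R,
  forall v, 'D_v (cone_map f wa wb) y0 = 0 -> v = 0.
Proof.
have df := (Cf 1).1 y0 Oy0.
pose F : {linear 'rV[R]_3 -> H2 R} := 'd f y0.
have FE v : 'D_v f y0 = F v by rewrite (deriveE _ df).
have pos v : v != 0 -> H2_metric (F v) (F v) != 0.
  by move=> v0; rewrite -FE gt_eqF// (f_pos Oy0 v0).
have [a a0 aV] := @H2_orthogonal R F [:: V y0] isT.
have [b b0 bV] := @H2_orthogonal R F [:: V y0; a] isT.
exists (F a), (F b) => v Dv; apply/eqP; apply: contraT => v0; exfalso.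
have Oc := cone_dom_y0 f_pos l0 DV Oy0 V0.
have [e1 e2' e3'] := derive_cone_map oO Cf (F a) (F b) v Oc.
rewrite Dv !mxE in e1 e2' e3'; symmetry in e1, e2', e3'.
have Dr := etrans (esym (FE v))
  (etrans (derive_radius_direction oO Cf v Oc) (scale_add0 _ _ e3')).
have va : H2_metric (F v) (F a) = 0.
  by rewrite Dr H2_metricZl; move: e1 => ->; rewrite mulr0.
have vb : H2_metric (F v) (F b) = 0.
  by rewrite Dr H2_metricZl; move: e2' => ->; rewrite mulr0.
have vV : H2_metric (F v) (F (V y0)) = 0.
  rewrite -!FE (DV Oy0) H2_metricZr -(derive_radius oO Cf v Oc) e3'.
  by rewrite mulr0 mulr0.
have aV' := aV _ (mem_head _ _).
have bV' : H2_metric (F b) (F (V y0)) = 0 by apply: bV; rewrite !inE eqxx.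
have ba : H2_metric (F b) (F a) = 0 by apply: bV; rewrite !inE eqxx orbT.
pose s (i : 'I_4) := nth 0 [:: V y0; a; b; v] i.
have s0 i : s i != 0 by case: i => [[|[|[|[|m]]]] hi].
have half (i j : 'I_4) : (i < j)%N -> H2_metric (F (s j)) (F (s i)) = 0.
  by case: i => [[|[|[|[|m]]]] hi]//; case: j => [[|[|[|[|k]]]] hj].
apply: (@orthogonal_family R F s) => [i|i j]; first exact: pos.
rewrite -(inj_eq val_inj)/= neq_ltn => /orP[] ij.
  by rewrite H2_metricC; exact: half.
exact: half.
Qed.

End ConeRegular.

(** * The cone chart *)

Section ChangeChart.
Variables (R : realType) (B : oriented_manifold R 3) (E : normedModType R).
Variables (c : chart B 'rV[R]_3) (N : set 'rV[R]_3) (P : set E).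
Variables (psi : 'rV[R]_3 -> E) (theta : E -> 'rV[R]_3).
Hypothesis ac : atlas c.
Hypothesis oN : open N.
Hypothesis oP : open P.
Hypothesis NO : N `<=` cimg c.
Hypothesis psiP : forall y, N y -> P (psi y) /\ theta (psi y) = y.
Hypothesis thetaP : forall z, P z -> N (theta z) /\ psi (theta z) = z.
Hypothesis Cpsi : smooth_on N psi.
Hypothesis Ctheta : smooth_on P theta.

(** The new chart is [psi] after [c]; its transition maps are those of [c] composed with [psi] or
    [theta], passing through row vectors as [C_on_comp] requires. *)
Lemma change_chart : exists k : chart B E,
  [/\ cdom k = cdom c `&` cmap c @^-1` N, cinv k = cinv c \o theta,
      cimg k = P & forall c', atlas c' -> compatible c' k].
Proof.
pose D : set B := cdom c `&` cmap c @^-1` N.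
pose m := psi \o cmap c; pose i := cinv c \o theta.
have oD : open D.
  rewrite openE => b [cb Nb]; apply: filterI.
    by apply: open_nbhs_nbhs; split => //; exact: cdom_open.
  by apply: (cmap_continuous_at cb); exact: open_nbhs_nbhs.
have img : m @` D = P.
  apply/seteqP; split => [_ [b [cb Nb] <-]|z Pz]; first by have [] := psiP Nb.
  have [Nt tz] := thetaP Pz; exists (i z); last first.
    by rewrite /m /i/= cinvK//; exact: NO.
  split; first by apply: cimg_cdom; exact: NO.
  by rewrite /i/= cinvK//; exact: NO.
have iK b : D b -> i (m b) = b.
  by move=> [cb Nb]; rewrite /i /m/= (psiP Nb).2 cmapK.
have cm : {within D, continuous m}.
  rewrite (continuous_open_subspace m oD) => b; rewrite inE => -[cb Nb].
  apply: continuous_comp; first exact: cmap_continuous_at.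
  exact: (C_on_continuous (Cpsi 0) Nb).
have ci : {within m @` D, continuous i}.
  rewrite img (continuous_open_subspace i oP) => z; rewrite inE => Pz.
  apply: continuous_comp; first exact: (C_on_continuous (Ctheta 0) Pz).
  by apply: cinv_continuous_at; apply: NO; have [] := thetaP Pz.
have oI : open (m @` D) by rewrite img.
pose k : chart B E := Chart oD oI iK cm ci.
exists k; split => // c' ac'; split => j.
- have oS : open (cmap c' @` (cdom c' `&` D)) by exact: open_chart_image.
  have C1 : C_on j (cmap c' @` (cdom c' `&` D)) (transition c' c).
    apply: C_on_sub ((atlas_compatible ac' ac).1 j).
    by move=> _ [b [c'b [cb _]] <-]; exists b.
  apply: (C_on_comp oS _ C1 (Cpsi j)) => _ [b [c'b [cb Nb]] <-].
  by rewrite /transition/= cmapK.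
- have oS : open (cmap k @` (cdom c' `&` cdom k)).
    by rewrite setIC; apply: open_chart_image; exact: cdom_open.
  have C1 : C_on j (cmap k @` (cdom c' `&` cdom k)) theta.
    apply: C_on_sub (Ctheta j) => _ [b [_ Db] <-].
    by rewrite -img; exists b.
  apply: (C_on_comp oS _ C1 ((atlas_compatible ac ac').1 j)).
  move=> _ [b [c'b [cb Nb]] <-]; exists b => //.
  by rewrite /k/= /m/= (psiP Nb).2.
Qed.

End ChangeChart.

Section Model.
Variable R : realType.
Notation M2 := ('rV[R]_2 * R^o)%type.

(** Identifies the product model of the cone chart with R^3, where the inverse function theorem is
    available. *)
Definition model_join (z : M2) : 'rV[R]_3 :=
  \row_j nth 0 [:: z.1 ord0 (inord 0); z.1 ord0 (inord 1); z.2] j.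

Definition model_split (w : 'rV[R]_3) : M2 :=
  (\row_j w ord0 (inord (j : 'I_2)), w ord0 (inord 2)).

Lemma model_joinE z : [/\ model_join z ord0 (inord 0) = z.1 ord0 (inord 0),
  model_join z ord0 (inord 1) = z.1 ord0 (inord 1) &
  model_join z ord0 (inord 2) = z.2].
Proof. by split; rewrite mxE inordK. Qed.

Lemma rV2P (a b : 'rV[R]_2) : a ord0 (inord 0) = b ord0 (inord 0) ->
  a ord0 (inord 1) = b ord0 (inord 1) -> a = b.
Proof.
move=> e0 e1; apply/rowP => j; rewrite -[j]inord_val.
by case: j => -[|[|j]].
Qed.

Lemma model_joinK : cancel model_join model_split.
Proof.
move=> [s r]; have [e0 e1 e2'] := model_joinE (s, r).
by congr pair => //; apply: rV2P; rewrite mxE inordK.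
Qed.

Lemma model_splitK : cancel model_split model_join.
Proof.
move=> w; have [e0 e1 e2'] := model_joinE (model_split w).
by apply: rV3P; rewrite ?e0 ?e1 ?e2'//= mxE inordK.
Qed.

Lemma model_join_is_linear : linear model_join.
Proof.
move=> k [s r] [s' r']; have [a0 a1 a2] := model_joinE (k *: (s, r) + (s', r')).
have [b0 b1 b2] := model_joinE (s, r); have [c0 c1 c2] := model_joinE (s', r').
apply: rV3P; rewrite [RHS]mxE [X in _ = X + _]mxE.
- by rewrite a0 b0 c0/= !mxE.
- by rewrite a1 b1 c1/= !mxE.
- by rewrite a2 b2 c2.
Qed.

HB.instance Definition _ :=
  GRing.isLinear.Build R M2 'rV[R]_3 _ model_join model_join_is_linear.

Lemma model_split_is_linear : linear model_split.
Proof.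
move=> k v w; congr pair; last by rewrite !mxE.
by apply/rowP => j; rewrite !mxE.
Qed.

HB.instance Definition _ :=
  GRing.isLinear.Build R 'rV[R]_3 M2 _ model_split model_split_is_linear.

Lemma model_split_continuous : continuous model_split.
Proof. exact: rV_linear_continuous. Qed.

Lemma model_join_continuous : continuous model_join.
Proof.
have oT : open [set: M2] by exact: openT.
have C1 : C_on 0 setT (fun z : M2 => z.1) by move=> z _; exact: cvg_fst.
have C2 : C_on 0 setT (fun z : M2 => z.2) by move=> z _; exact: cvg_snd.
have C : C_on 0 setT model_join.
  apply: (C_on_mx oT) => i j.
  have -> : (fun z => model_join z i j : R^o) =
      fun z : M2 => nth 0 [:: z.1 ord0 (inord 0); z.1 ord0 (inord 1); z.2] j.
    by apply/funext => z; rewrite mxE.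
  case: j => [[|[|[|j]]] hj] //=.
  - exact: (C_on_mxcoord _ _ oT C1).
  - exact: (C_on_mxcoord _ _ oT C1).
by move=> z; exact: C.
Qed.

End Model.

Section GramSurface.
Variables (R : realType) (S : set 'rV[R]_2) (u1 : 'rV[R]_2 -> H2 R).
Hypothesis oS : open S.
Hypothesis C1 : smooth_on S u1.

Lemma gram_smooth : smooth_on S (gram u1).
Proof.
move=> k; apply: (C_on_mx oS) => i j.
have -> : (fun s => gram u1 s i j : R^o) = fun s =>
    H2_metric ('D_(basis_vec R i) u1 s) ('D_(basis_vec R j) u1 s).
  by apply/funext => s; rewrite mxE.
exact: (C_on_bilinear (@H2_metric_continuous R) oS ((C1 k.+1).2 _) ((C1 k.+1).2 _)).
Qed.

Lemma gram_sym s : (gram u1 s)^T = gram u1 s.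
Proof. by apply/matrixP => i j; rewrite !mxE /induced_metric H2_metricC. Qed.

Lemma gram_form s (a b : 'rV[R]_2) : S s ->
  (a *m gram u1 s *m b^T) ord0 ord0 = H2_metric ('D_a u1 s) ('D_b u1 s).
Proof.
move=> Ss; have du := (C1 1).1 s Ss.
rewrite (derive_basis a du) (derive_basis b du) H2_metric_suml -mulmxA mxE.
apply: eq_bigr => i _; congr (_ * _).
rewrite H2_metricC H2_metric_suml mxE; apply: eq_bigr => j _.
by rewrite !mxE /induced_metric mulrC H2_metricC.
Qed.

End GramSurface.

(** * The immersion is a cone near a point where the field does not vanish *)

Lemma itv_dist (R : realType) (x y w : R) : y - w < x -> x < y + w -> `|y - x| < w.
Proof. by move=> h1 h2; rewrite ltr_distl; apply/andP; split; lra. Qed.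

Lemma itv_convex (R : realType) (a b x y t : R) : a < x < b -> a < y -> y < b ->
  0 <= t -> t <= 1 -> a < x + t * (y - x) < b.
Proof.
move=> /andP[ax xb] ay yb t0 t1.
have -> : x + t * (y - x) = (1 - t) * x + t * y by ring.
have [tlt|t1'] := ltP t 1; last first.
  have -> : t = 1 by lra.
  by rewrite subrr mul0r mul1r add0r ay yb.
have h1 : (1 - t) * a < (1 - t) * x by rewrite ltr_pM2l// subr_gt0.
have h2 : (1 - t) * x < (1 - t) * b by rewrite ltr_pM2l// subr_gt0.
have h3 : t * a <= t * y by rewrite ler_wpM2l// ltW.
have h4 : t * y <= t * b by rewrite ler_wpM2l// ltW.
by apply/andP; split; lra.
Qed.

Section ConeNear.
Variables (R : realType) (B : oriented_manifold R 3) (u : B -> H2 R).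
Variable c : chart B 'rV[R]_3.
Hypothesis ac : atlas c.
Variables (V : 'rV[R]_3 -> 'rV[R]_3) (l : R) (b0 : B).
Let O := cimg c.
Let f : 'rV[R]_3 -> H2 R := u \o cinv c.
Let y0 := cmap c b0.
Hypothesis cb0 : cdom c b0.
Hypothesis Cf : smooth_on O f.
Hypothesis f_pos : forall y, O y -> forall a, a != 0 ->
  0 < H2_metric ('D_a f y) ('D_a f y).
Hypothesis l0 : l != 0.
Hypothesis DV : forall y, O y -> 'D_(V y) f y = l *: f y.
Hypothesis V0 : V y0 != 0.

Notation M2 := ('rV[R]_2 * R^o)%type.

Lemma cone_near : is_cone_near u b0.
Proof.
have oO : open O by exact: cimg_is_open.
have Oy0 : O y0 by exists b0.
have oD := cone_dom_open oO Cf.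
have Dy0 := cone_dom_y0 f_pos l0 DV Oy0 V0.
have [wa [wb inj0]] := cone_map_regular oO Cf f_pos l0 DV Oy0 V0.
pose psi := cone_map f wa wb.
have Cpsi : smooth_on (cone_dom O f) psi by exact: (cone_map_smooth oO Cf).
have [N [theta [oN Ny0 ND oN' [thetaK Ctheta injN]]]] :=
  inverse_function oD Dy0 Cpsi inj0.
pose rho0 := radius f y0.
have rho0_gt0 : 0 < rho0 by exact: radius_gt0 Dy0.
have psi2 y : psi y ord0 (inord 2) = radius f y by have [] := cone_mapE f wa wb y.
pose P' : set M2 := @model_join R @^-1` (psi @` N).
have oP' : open P'.
  by apply: open_comp => // z _; exact: model_join_continuous.
pose s0 := (model_split (psi y0)).1.
have z0E : model_split (psi y0) = (s0, rho0 : R^o).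
  by rewrite /s0 /model_split /= psi2.
have P'z0 : P' (s0, rho0 : R^o).
  by rewrite /P'/= -z0E model_splitK; exists y0.
have [e /= e0 eP] := (nbhs_ballP ((s0, rho0) : M2) _).1
  (open_nbhs_nbhs (conj oP' P'z0)).
(* The bound [e] keeps the box [P] inside the image of the coordinates, and [rho0] keeps its lower
   radius nonnegative. *)
pose d := Num.min e rho0.
have d0 : 0 < d by rewrite lt_min e0.
pose S : set 'rV[R]_2 := ball s0 d.
have oS : open S by exact: ball_open.
pose r0 := rho0 - d; pose r1 := rho0 + d.
have r0_ge0 : 0 <= r0 by rewrite subr_ge0 ge_min lexx orbT.
have rho_in : r0 < rho0 < r1.
  by rewrite /r0 /r1 ltrBlDr !ltrDl d0.
pose P : set M2 := S `*` `]r0, r1[.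
have oP : open P.
  have -> : P = (fst @^-1` S) `&` (snd @^-1` [set` `]r0, r1[]) by [].
  apply: openI; apply: open_comp => //.
  - by move=> z _; exact: cvg_fst.
  - by move=> z _; exact: cvg_snd.
have PE s r : P (s, r) <-> S s /\ r0 < r < r1.
  by split => -[Ss]; [rewrite /= in_itv|split => //=; rewrite in_itv].
have PP' : P `<=` P'.
  move=> [s r] /PE[Ss /andP[rr0 rr1]]; apply: eP; split => /=.
    by apply: le_ball Ss; rewrite /d ge_min lexx.
  apply: (@le_ball _ _ _ d); first by rewrite /d ge_min lexx.
  by rewrite -ball_normE /=; exact: itv_dist.
pose psiM y : M2 := model_split (psi y).
pose thetaM (z : M2) := theta (model_join z).
pose N1 : set 'rV[R]_3 := N `&` psiM @^-1` P.
have CpsiM : smooth_on N psiM.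
  move=> k; apply: (C_on_linear_comp oN (@model_split_continuous R)).
  by apply: C_on_sub ND _; exact: Cpsi.
have oN1 : open N1.
  rewrite openE => y [Ny Py]; apply: filterI.
    by apply: open_nbhs_nbhs; split.
  have cy : {for y, continuous psiM} by exact: (C_on_continuous (CpsiM 0) Ny).
  have nP : nbhs (psiM y) P by apply: open_nbhs_nbhs; split.
  exact: cy nP.
have psiMP y : N1 y -> P (psiM y) /\ thetaM (psiM y) = y.
  by move=> [Ny Py]; split => //; rewrite /thetaM /psiM model_splitK thetaK.
have thetaMP z : P z -> N1 (thetaM z) /\ psiM (thetaM z) = z.
  move=> Pz; have [y Ny yz] := PP' z Pz.
  have ty : thetaM z = y by rewrite /thetaM -yz thetaK.
  have pz : psiM y = z by rewrite /psiM yz model_joinK.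
  by rewrite ty pz; split => //; split => //; rewrite /= pz.
have CthetaM : smooth_on P thetaM.
  move=> k; apply: C_on_sub PP' _.
  exact: (C_on_comp_linear oN' (@model_join_continuous R) (Ctheta k)).
have N1O : N1 `<=` cimg c by move=> y [/ND[]].
have CpsiM1 : smooth_on N1 psiM by move=> k; apply: C_on_sub (CpsiM k) => y [].
have [k [dk ik imk compk]] :=
  change_chart ac oN1 oP N1O psiMP thetaMP CpsiM1 CthetaM.
have thetaD z : P z -> cone_dom O f (thetaM z).
  by move=> /thetaMP[[Nt _] _]; exact: ND.
have psi_theta z : P z -> psi (thetaM z) = model_join z.
  by move=> /thetaMP[_ e']; rewrite -[in RHS]e' /psiM model_splitK.
have rad z : P z -> radius f (thetaM z) = z.2.
  by move=> Pz; rewrite -psi2 psi_theta//; have [] := model_joinE z.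
have dpsi z : P z -> differentiable psi (thetaM z).
  by move=> /thetaD; exact: (Cpsi 1).1.
have dtheta z : P z -> differentiable thetaM z by exact: (CthetaM 1).1.
have Dpsi_theta z w : P z -> 'D_('D_w thetaM z) psi (thetaM z) = model_join w.
  move=> Pz; apply: (etrans (esym (derive_comp w (dtheta z Pz) (dpsi z Pz)))).
  have E : 'D_w (psi \o thetaM) z = 'D_w (@model_join R) z.
    apply: near_eq_derive; apply: filterS (open_nbhs_nbhs (conj oP Pz)).
    exact: psi_theta.
  apply: (etrans E); exact: (derive_linear z w (@model_join_continuous R)).
pose g := direction f \o thetaM.
have dn z : P z -> differentiable (direction f) (thetaM z).
  by move=> /thetaD; exact: (direction_smooth oO Cf 1).1.
have dg z : P z -> differentiable g z.
  by move=> Pz; apply: differentiable_comp; [exact: dtheta|exact: dn].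
(* The coordinate field of the radius is [V] divided by [l * radius]: both have the same image under
   the differential of [psi], which is injective on [N]. Along [V] the direction is constant. *)
have Dg_radial z : P z -> 'D_((0, 1) : M2) g z = 0.
  move=> Pz; pose y := thetaM z; have Dy := thetaD z Pz.
  pose v := 'D_((0, 1) : M2) thetaM z.
  pose k0 := (l * radius f y)^-1.
  have lr0 : l * radius f y != 0 by rewrite mulf_neq0// (radius_neq0 Dy).
  have [a0 a1 a2] := derive_cone_map_field oO Cf DV wa wb Dy.
  have [j0 j1 j2] := model_joinE ((0, 1) : M2).
  have dpy : differentiable psi y by exact: dpsi.
  have Dk : 'D_(k0 *: V y) psi y = model_join ((0, 1) : M2).
    rewrite (deriveZdir _ _ dpy); apply: rV3P; rewrite [LHS]mxE.
    - by rewrite a0 j0 mulr0/= mxE.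
    - by rewrite a1 j1 mulr0/= mxE.
    - by rewrite a2 j2 mulVf.
  have Dv : 'D_(v - k0 *: V y) psi y = 0.
    rewrite -scaleN1r (deriveDdir _ _ dpy) (deriveZdir _ _ dpy) Dk.
    by rewrite (Dpsi_theta z _ Pz) scaleN1r subrr.
  have Ny : N y by have [[]] := thetaMP z Pz.
  have vE : v = k0 *: V y by apply/eqP; rewrite -subr_eq0; apply/eqP/(injN y Ny).
  apply: (etrans (derive_comp _ (dtheta z Pz) (dn z Pz))).
  rewrite -/v vE (deriveZdir _ _ (dn z Pz)).
  by rewrite (derive_direction_field oO Cf DV Dy) scaler0.
(* The link of the cone is the direction on the slice through the base point; by [g_u1] every other
   radius gives the same value, the radial segment to the slice staying in the box. *)
pose u1 s : H2 R := g (s, rho0).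
have PS s : S s -> P (s, rho0) by move=> Ss; apply/PE.
have g_u1 s r : P (s, r) -> g (s, r) = u1 s.
  move=> /PE[Ss /andP[rr0 rr1]]; apply/eqP; rewrite -subr_eq0 -normr_le0 /u1.
  have seg (t : R) : 0 <= t <= 1 ->
      P ((s, rho0 : R^o) + t *: ((0, r - rho0) : M2)).
    move=> /andP[t0 t1]; rewrite (_ : _ + _ = (s, rho0 + t * (r - rho0))); last first.
      by congr pair; rewrite /= scaler0 addr0.
    by apply/PE; split => //; exact: itv_convex.
  have -> : g (s, r) = g ((s, rho0 : R^o) + ((0, r - rho0) : M2)).
    by congr (g _); congr pair; rewrite /= ?addr0// subrKC.
  apply: mean_value_inequality => t t01; first by apply: dg; exact: seg.
  have dirE : ((0, r - rho0) : M2) = (r - rho0) *: ((0, 1) : M2).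
    by congr pair; rewrite /= ?scaler0// /GRing.scale/= mulr1.
  have Pt := seg t t01.
  have D0 w : w = (r - rho0) *: ((0, 1) : M2) ->
      'D_w g ((s, rho0 : R^o) + t *: ((0, r - rho0) : M2)) = 0.
    by move=> ->; rewrite (deriveZdir _ _ (dg _ Pt)) (Dg_radial _ Pt) scaler0.
  by rewrite (D0 _ dirE) normr0.
have Cu1 : smooth_on S u1.
  move=> j.
  have C1 : C_on j S (fun s => model_join (s, rho0)).
    apply: (C_on_mx oS) => i p.
    have Cid : C_on j S (fun s : 'rV[R]_2 => s).
      by apply: (@C_on_linear _ _ _ j S idfun) => ?; exact: cvg_id.
    have -> : (fun s => model_join (s, rho0) i p : R^o) = fun s : 'rV[R]_2 =>
        nth 0 [:: s ord0 (inord 0); s ord0 (inord 1); rho0] p.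
      by apply/funext => s; rewrite mxE.
    case: p => [[|[|[|p]]] hp] //=.
    - exact: (C_on_mxcoord _ _ oS Cid).
    - exact: (C_on_mxcoord _ _ oS Cid).
    - exact: C_on_cst.
  have C2 := C_on_comp oS (fun s Ss => PP' _ (PS s Ss)) C1 (Ctheta j).
  exact: (C_on_comp oS (fun s Ss => thetaD _ (PS s Ss)) C2 (direction_smooth oO Cf j)).
have u1_norm s : S s -> H2_metric (u1 s) (u1 s) = 1.
  by move=> Ss; apply: direction_norm; apply: thetaD; exact: PS.
have du1 s : S s -> differentiable u1 s by exact: (Cu1 1).1.
(* Differentiating the constant norm of [u1]; this is why the metric has no cross term between the
   radius and the surface. *)
have u1_orth s a : S s -> H2_metric ('D_a u1 s) (u1 s) = 0.
  move=> Ss.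
  have E : 'D_a (fun s => H2_metric (u1 s) (u1 s) : R^o) s = 'D_a (cst (1 : R^o)) s.
    apply: near_eq_derive; apply: filterS (open_nbhs_nbhs (conj oS Ss)).
    exact: u1_norm.
  have := etrans (esym (derive_metric_self a (du1 s Ss))) (etrans E (derive_cst _ _ _)).
  by move/eqP; rewrite mulf_eq0 pnatr_eq0/= => /eqP.
have ukE s r : P (s, r) -> (u \o cinv k) (s, r) = r *: u1 s.
  move=> Psr; rewrite ik -(g_u1 s r Psr).
  exact: (etrans (radius_direction (thetaD _ Psr)) (congr1 ( *:%R^~ _) (rad _ Psr))).
have Duk s r (a : M2) : P (s, r) ->
    'D_a (u \o cinv k) (s, r) = a.2 *: u1 s + r *: 'D_(a.1) u1 s.
  move=> Psr; have /PE[Ss _] := Psr.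
  have E : 'D_a (u \o cinv k) (s, r) =
      'D_a (fun z : M2 => z.2 *: (u1 \o fst) z) (s, r).
    apply: near_eq_derive; apply: filterS (open_nbhs_nbhs (conj oP Psr)).
    by move=> [s' r'] Psr'; exact: ukE.
  have cs : continuous (snd : {linear M2 -> R^o}) by move=> ?; exact: cvg_snd.
  have cf : continuous (fst : {linear M2 -> 'rV[R]_2}) by move=> ?; exact: cvg_fst.
  have ds := @linear_differentiable _ _ _ (snd : {linear M2 -> R^o}) (s, r) cs.
  have df := @linear_differentiable _ _ _ (fst : {linear M2 -> 'rV[R]_2}) (s, r) cf.
  have dc : differentiable (u1 \o fst) ((s, r) : M2).
    by apply: differentiable_comp; [exact: df|exact: du1].
  apply: (etrans E); apply: (etrans (derive_scale a ds dc)).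
  have D1 := @derive_linear _ _ _ (snd : {linear M2 -> R^o}) (s, r) a cs.
  have D2 := @derive_fst _ _ _ _ u1 (s, r) a (du1 s Ss).
  exact: (congr2 (fun (k1 : R) w => k1 *: u1 s + r *: w) D1 D2).
have metricE : forall s r, P (s, r) -> forall a b : M2,
    induced_metric (u \o cinv k) (s, r) a b =
      a.2 * b.2 + r ^+ 2 * (a.1 *m gram u1 s *m b.1^T) ord0 ord0.
  move=> s r Psr a b; have /PE[Ss _] := Psr.
  rewrite (gram_form Cu1 _ _ Ss) /induced_metric (Duk _ _ a Psr) (Duk _ _ b Psr).
  have := u1_norm s Ss; have := u1_orth s a.1 Ss; have := u1_orth s b.1 Ss.
  move: ('D_(a.1) u1 s) ('D_(b.1) u1 s) (u1 s) => A1 B1 w wB wA ww.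
  rewrite !(H2_metricDl, H2_metricDr, H2_metricZl, H2_metricZr) (H2_metricC w B1).
  by rewrite ww wA wB; ring.
exists k, S, r0, r1, u1, (gram u1); split => //.
- by rewrite dk; split => //; split => //; rewrite /= /psiM z0E; apply/PE; split => //;
    exact: ballxx.
- by split => //; move: rho_in => /andP[h1 h2]; exact: lt_trans h1 h2.
- split => //.
  + by move=> s r Ss rr; apply: ukE; apply/PE.
  + exact: (gram_smooth oS Cu1).
  + move=> s Ss; split; first exact: gram_sym.
    move=> a a0.
    have Ps := PS s Ss.
    have := metricE _ _ Ps ((a, 0) : M2) ((a, 0) : M2).
    rewrite /= mul0r add0r /induced_metric.
    have E : 'D_((a, 0) : M2) (u \o cinv k) (s, rho0 : R^o) =
        'D_('D_((a, 0) : M2) thetaM (s, rho0 : R^o)) f (thetaM (s, rho0 : R^o)).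
      have df : differentiable f (thetaM (s, rho0 : R^o)).
        by apply: (Cf 1).1; apply: N1O; have [] := thetaMP _ Ps.
      by rewrite ik; exact: (derive_comp _ (dtheta _ Ps) df).
    rewrite E => e1.
    (* Positivity of the surface metric is inherited from the induced metric: a surface vector comes
       from a nonzero tangent vector, whose square is [rho0 ^+ 2] times the value to be bounded. *)
    have w0 : 'D_((a, 0) : M2) thetaM (s, rho0 : R^o) != 0.
      apply: contra_neq a0 => w0; have := Dpsi_theta _ ((a, 0) : M2) Ps.
      rewrite w0 derive0 => /(congr1 (@model_split R)); rewrite model_joinK linear0.
      by move=> /(congr1 fst)/esym.
    have Oy : O (thetaM (s, rho0 : R^o)) by apply: N1O; have [] := thetaMP _ Ps.
    have := f_pos Oy w0; rewrite e1 pmulr_rgt0//.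
    by rewrite exprn_gt0.
- by move=> s r Ss rr a b; apply: metricE; apply/PE.
Qed.

End ConeNear.

(** * The translated immersion and the conclusion *)

Lemma derive_add_cst (R : realType) (E F : normedModType R) (f : E -> F) x v (a : F) :
  differentiable f x -> 'D_v (fun y => f y + a) x = 'D_v f x.
Proof.
move=> df; have dc := differentiable_cst a x.
apply: (etrans (deriveD (diff_derivable df) (diff_derivable dc))).
by rewrite derive_cst addr0.
Qed.

Section ConeAt.
Variables (R : realType) (B : oriented_manifold R 3) (u : B -> H2 R).
Variables (U : vector_field B) (c0 : H2 R) (l : R).
Hypothesis u_immersion : is_immersion u.
Hypothesis g_positive : positive_definite_metric u.
Hypothesis U_T4 : commutes_with_T4 U.
Hypothesis l0 : l != 0.
Hypothesis c0P : forall c, atlas c -> forall b, cdom c b ->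
  'D_((vcomp U c (b, 0)).1) (u \o cinv c) (cmap c b) = l *: (u b + c0).

Let u' b := u b + c0.

Lemma derive_shift c y a : atlas c -> cimg c y ->
  'D_a (u' \o cinv c) y = 'D_a (u \o cinv c) y.
Proof.
move=> ac Oy; apply: (@derive_add_cst _ _ _ (u \o cinv c)).
exact: (immersion_diff u_immersion ac).
Qed.

Lemma derive_center c (p : B * T4 R) : atlas c -> cdom c p.1 ->
  'D_((vcomp U c p).1) (u' \o cinv c) (cmap c p.1) = l *: u' p.1.
Proof.
move=> ac cp; rewrite (vcomp_fiber U_T4 ac cp).
apply: (etrans (derive_shift _ ac _)); first by exists p.1.
exact: c0P.
Qed.

Lemma cone_at c (p : B * T4 R) : atlas c -> cdom c p.1 ->
  (vcomp U c p).1 != 0 -> is_cone_near u' p.1.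
Proof.
move=> ac cp; rewrite (vcomp_fiber U_T4 ac cp) => V0.
apply: (@cone_near R B u' c ac (fun y => (field_at U c y).1) l p.1 cp) => //.
- move=> k; apply: (C_onD (cimg_is_open (c := c)) (immersion_smooth u_immersion ac k)).
  exact: C_on_cst.
- by move=> y Oy a a0; rewrite (derive_shift _ ac Oy); exact: (metric_gt0 g_positive ac Oy a0).
- move=> y Oy; have := derive_center (p := (cinv c y, 0)) ac (cimg_cdom Oy).
  by rewrite /= (cinvK Oy).
- by rewrite /field_at cmapK.
Qed.

End ConeAt.

Unset Implicit Arguments.

Theorem mainTheorem10 (R : realType) (B : oriented_manifold R 3)
  (B_connected : connected [set: B])
  (u : B -> H2 R)
  (u_immersion : is_immersion u)
  (g_positive : positive_definite_metric u)
  (u_minimal : is_minimal u)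
  (phi_G2 : is_G2_form u)
  (U : vector_field B) (lambda : B * T4 R -> R)
  (U_T4 : commutes_with_T4 U)
  (U_phi : lie_equation u U lambda) :
  (exists l : R, forall p, lambda p = l) /\
  (exists w : 'rV[R]_4, forall c, atlas c -> forall p : B * T4 R,
      cdom c p.1 -> (vcomp U c p).2 = w) /\
  (forall l : R, (forall p, lambda p = l) -> l != 0 ->
    exists c0 : H2 R,
      let u' := fun b => u b + c0 in
      (forall c, atlas c -> forall p : B * T4 R, cdom c p.1 ->
         'D_((vcomp U c p).1) (u' \o cinv c) (cmap c p.1) = l *: u' p.1) /\
      (forall c, atlas c -> forall p : B * T4 R, cdom c p.1 ->
         (vcomp U c p).1 != 0 -> is_cone_near u' p.1)).
Proof.
(* An empty [B] counts as connected here; all claims are then vacuous and the witnesses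
   arbitrary. *)
have [[b0 _]|noB] := pselect (exists b : B, True); last first.
  have nop (p : B * T4 R) : False by apply: noB; exists p.1.
  split; first by exists 0 => p; case: (nop p).
  split; first by exists 0 => c _ p; case: (nop p).
  by move=> l _ _; exists 0; split => c _ p; case: (nop p).
split; [|split].
- exists (lambda (b0, 0)) => p.
  exact: (lambda_global B_connected u_immersion g_positive U_T4 U_phi).
- exists (fiber_part U b0) => c ac p cp.
  rewrite (vcomp_fiber U_T4 ac cp) -(fiber_partE U ac cp).
  exact: (fiber_part_global B_connected u_immersion g_positive U_T4 U_phi).
- move=> l ll l0.
  have [c0 c0P] := center_global B_connected u_immersion U_T4 U_phi ll l0.
  exists c0; split => c ac p cp.
  + exact: (derive_center u_immersion U_T4 c0P ac cp).
  + move=> V0; exact: (cone_at u_immersion g_positive U_T4 l0 c0P ac cp V0).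
Qed.
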